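(* Let $\Omega\subseteq\mathbf{R}^n$, $n\ge1$, be an open set and let $\sigma\in D'(\Omega)$ be a real-valued distribution. Let $\mathcal{A}:\Omega\to\mathbf{R}^{n\times n}$ be a symmetric real matrix-valued function for which there are $m,M>0$ such that for almost every $x\in\Omega$, $m|\xi|^2\le\mathcal{A}(x)\xi\cdot\xi$ and $|\mathcal{A}(x)\xi|\le M|\xi|$ for all $\xi\in\mathbf{R}^n$. Then $$\langle\sigma,h^2\rangle\le\int_\Omega(\mathcal{A}\nabla h)\cdot\nabla h\,dx\quad\text{for all }h\in C_0^\infty(\Omega)$$ if and only if there exists a vector field $\vec\Gamma\in L^2_{\rm loc}(\Omega)^n$ such that $$\sigma\le{\rm div}(\mathcal{A}\vec\Gamma)-(\mathcal{A}\vec\Gamma)\cdot\vec\Gamma\quad\text{in }D'(\Omega).$$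
   Context: An inequality $\mu\le\nu$ in $D'(\Omega)$ means $\langle\mu,\varphi\rangle\le\langle\nu,\varphi\rangle$ for all $\varphi\in C_0^\infty(\Omega)$ with $\varphi\ge0$. *)

(* Defs.v *)
(* R^n is 'rV[R]_n for R : realType. *)
From HB Require Import structures.
From mathcomp Require Import all_boot all_order all_algebra.
From mathcomp Require Import all_classical all_reals all_analysis.

Set Implicit Arguments.
Unset Strict Implicit.
Unset Printing Implicit Defensive.

Import Order.TTheory GRing.Theory Num.Theory.
Import numFieldNormedType.Exports.

Local Open Scope classical_set_scope.
Local Open Scope ring_scope.

Section borel_rV.
Variables (R : realType) (n : nat).

Definition rV_coord (i : 'I_n) (x : 'rV[R]_n) : measurableTypeR R := x ord0 i.

Definition rV_display : measure_display.
Proof. exact: default_measure_display. Qed.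

Let rV_borel0 : g_sigma_preimage rV_coord set0.
Proof. exact: sigma_algebra0. Qed.

Let rV_borelC A : g_sigma_preimage rV_coord A ->
  g_sigma_preimage rV_coord (~` A).
Proof. exact: sigma_algebraC. Qed.

Let rV_borel_bigcup (F : (set 'rV[R]_n)^nat) :
  (forall i, g_sigma_preimage rV_coord (F i)) ->
  g_sigma_preimage rV_coord (\bigcup_i (F i)).
Proof. exact: sigma_algebra_bigcup. Qed.

(* The product of the Borel sigma-algebras of the n coordinates, i.e., the
   Borel sigma-algebra of R^n. *)
HB.instance Definition _ := @isMeasurable.Build rV_display 'rV[R]_n
  (g_sigma_preimage rV_coord) rV_borel0 rV_borelC rV_borel_bigcup.

Lemma measurable_rV_coord (i : 'I_n) :
  measurable_fun [set: 'rV[R]_n] (rV_coord i).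
Proof.
move=> _ Y mY; rewrite setTI; apply: sub_sigma_algebra => /=.
rewrite -bigcup_seq/=; exists i => /=; first by rewrite mem_index_enum.
by exists Y => //; rewrite setTI.
Qed.

Lemma measurable_fun_rVP d (T : measurableType d) (f : T -> 'rV[R]_n) :
  (forall i, measurable_fun [set: T] (rV_coord i \o f)) ->
  measurable_fun [set: T] f.
Proof.
move=> mf.
have : g_sigma_preimage (fun i => rV_coord i \o f) `<=` measurable.
  apply: smallest_sub; first exact: sigma_algebra_measurable.
  rewrite -bigcup_seq /=; apply: bigcup_sub => i _ A [B mB <-].
  exact: mf.
rewrite g_sigma_preimage_comp => prefS _ A mA.
by apply: prefS; exists A.
Qed.

End borel_rV.

Section lebesgue_rV_step.
Variables (R : realType) (n : nat).

Definition rV_cons (p : measurableTypeR R * 'rV[R]_n) : 'rV[R]_n.+1 :=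
  row_mx (p.1 : R)%:M p.2 : 'rV[R]_(1 + n).

Definition rV_uncons (x : 'rV[R]_n.+1) : measurableTypeR R * 'rV[R]_n :=
  (x ord0 ord0, rsubmx (x : 'rV[R]_(1 + n))).

Lemma rV_cons0 p : rV_cons p ord0 ord0 = p.1.
Proof.
have -> : ord0 = lshift n (ord0 : 'I_1) :> 'I_(1 + n) by apply/val_inj.
by rewrite [LHS]row_mxEl mxE.
Qed.

Lemma rV_consS p (j : 'I_n) : rV_cons p ord0 (rshift 1 j) = p.2 ord0 j.
Proof. exact: row_mxEr. Qed.

Lemma rV_consK : cancel rV_cons rV_uncons.
Proof.
by move=> [a v]; rewrite /rV_uncons rV_cons0; congr pair; exact: row_mxKr.
Qed.

Lemma measurable_rV_cons : measurable_fun setT rV_cons.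
Proof.
apply: measurable_fun_rVP => i.
have [j ->|j ->] := @split_ordP 1 n i.
  rewrite (_ : _ \o _ = fst) //; apply/funext => p.
  by rewrite -rV_cons0 /rV_coord /=; congr (rV_cons _ _ _); apply/val_inj;
    rewrite /= (ord1 j).
rewrite (_ : _ \o _ = @rV_coord R n j \o snd); last first.
  by apply/funext => p; rewrite /rV_coord /= rV_consS.
by apply: measurableT_comp => //; exact: measurable_rV_coord.
Qed.

Lemma measurable_rV_uncons : measurable_fun setT rV_uncons.
Proof.
apply: measurable_fun_pair; first exact: (@measurable_rV_coord R n.+1 ord0).
apply: measurable_fun_rVP => i.
rewrite (_ : _ \o _ = @rV_coord R n.+1 (rshift 1 i)).
  exact: measurable_rV_coord.
by apply/funext => x; rewrite /rV_coord /= mxE.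
Qed.

Variable m : {sigma_finite_measure set 'rV[R]_n -> \bar R}.

Definition lebesgue_rV_step : set 'rV[R]_n.+1 -> \bar R :=
  pushforward ((@lebesgue_measure R) \x m)%E rV_cons.

HB.instance Definition _ := Measure.copy lebesgue_rV_step
  (measure_function_pushforward__canonical__measure_function_Measure
    ((@lebesgue_measure R) \x m)%E measurable_rV_cons).

Let lebesgue_rV_step_sigma_finite : sigma_finite setT lebesgue_rV_step.
Proof.
have /sigma_finiteP[/= F [UF ndF mF]] := sigma_finiteT (@lebesgue_measure R).
have /sigma_finiteP[/= G [UG ndG mG]] := sigma_finiteT m.
exists (fun k => rV_uncons @^-1` (F k `*` G k)).
  rewrite -preimage_bigcup -[LHS](preimage_setT rV_uncons); congr (_ @^-1` _).
  rewrite -setXTT UF UG predeqE => -[x y]; split.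
    move=> [/= [i _ Fix] [k _ Gky]]; exists (maxn i k) => //; split.
    - by move: x Fix; exact/subsetPset/ndF/leq_maxl.
    - by move: y Gky; exact/subsetPset/ndG/leq_maxr.
  by move=> [i _ []/= ? ?]; split; exists i.
move=> k; have [mFk Fkoo] := mF k; have [mGk Gkoo] := mG k; split.
  rewrite -[X in measurable X]setTI; apply: measurable_rV_uncons => //.
  exact: measurableX.
rewrite /lebesgue_rV_step /pushforward -comp_preimage.
rewrite (_ : _ \o _ = id); last by apply/funext => p; exact: rV_consK.
rewrite preimage_id product_measure1E//.
by rewrite lte_mul_pinfty// ge0_fin_numE.
Qed.

HB.instance Definition _ := @Measure_isSigmaFinite.Build _ _ _
  lebesgue_rV_step lebesgue_rV_step_sigma_finite.

End lebesgue_rV_step.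

(* Lebesgue measure on the Borel sets of R^n, as the n-fold product of the
   one-dimensional one; R^0 is a point, of measure 1. *)
Fixpoint borel_lebesgue_rV (R : realType) (n : nat) :
    {sigma_finite_measure set 'rV[R]_n -> \bar R} :=
  match n with
  | 0 => \d_ (0 : 'rV[R]_0)
  | m.+1 => lebesgue_rV_step (borel_lebesgue_rV R m)
  end.

Section lebesgue_rV.
Variables (R : realType) (n : nat).

Let mu : {measure set 'rV[R]_n -> \bar R} := borel_lebesgue_rV R n.

(* R^n with the sigma-algebra of its Lebesgue measurable sets. *)
Definition lebesgueTypeRn := caratheodory_type (mu^*)%mu.

HB.instance Definition _ := Measurable.on lebesgueTypeRn.

(* The completion of [borel_lebesgue_rV R n]. *)
Definition lebesgue_rV : set lebesgueTypeRn -> \bar R :=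
  @completed_measure_extension _ 'rV[R]_n R mu.

HB.instance Definition _ := Measure.on lebesgue_rV.

Let lebesgue_rV_sigma_finite : sigma_finite setT lebesgue_rV.
Proof. exact/completed_measure_extension_sigma_finite/sigma_finiteT. Qed.

HB.instance Definition _ := @Measure_isSigmaFinite.Build _ _ _
  lebesgue_rV lebesgue_rV_sigma_finite.

End lebesgue_rV.
Arguments lebesgue_rV {R n}.

Section euclidean.
Variables (R : realType) (n : nat).
Implicit Types (u v : 'rV[R]_n) (M : 'M[R]_n).

Definition dotv u v : R := \sum_i u ord0 i * v ord0 i.

(* The library norm on 'rV[R]_n is the maximum norm. *)
Definition enorm u : R := Num.sqrt (dotv u u).

(* The vector M u, with vectors written as rows. *)
Definition mulmv M u : 'rV[R]_n := u *m M^T.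

End euclidean.

Section test_functions.
Variables (R : realType) (n : nat).
Implicit Types (f phi : 'rV[R]_n -> R) (Omega K : set 'rV[R]_n).

Definition pderiv (i : 'I_n) f : 'rV[R]_n -> R :=
  fun x => 'D_(delta_mx ord0 i) f x.

Definition pderivs (s : seq 'I_n) f : 'rV[R]_n -> R := foldr pderiv f s.

Definition gradient f (x : 'rV[R]_n) : 'rV[R]_n := \row_i pderiv i f x.

(* All iterated partial derivatives exist and are continuous. *)
Definition smooth f : Prop := forall s : seq 'I_n,
  (forall i x, derivable (pderivs s f) x (delta_mx ord0 i)) /\
  continuous (pderivs s f).

Definition fsupp f : set 'rV[R]_n := closure [set x | f x != 0].

(* C_0^oo(Omega); a test function is extended by 0 to R^n. *)
Definition test_function Omega : set ('rV[R]_n -> R) :=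
  [set phi | [/\ smooth phi, compact (fsupp phi) & fsupp phi `<=` Omega]].

(* The C^N norm: the supremum over R^n of all partial derivatives of order at
   most N; a sequence s encodes the order of differentiation. *)
Definition CN_norm (N : nat) phi : R :=
  sup [set y : R | exists (s : seq 'I_n) (x : 'rV[R]_n),
                     (size s <= N)%N /\ y = `|pderivs s phi x|].

End test_functions.

Section distributions.
Variables (R : realType) (n : nat) (Omega : set 'rV[R]_n).
Implicit Types (sigma tau : ('rV[R]_n -> R) -> R) (phi psi : 'rV[R]_n -> R).

(* [sigma] restricted to test functions is linear and continuous, i.e., of
   finite order on every compact subset of Omega; only its values on test
   functions are meaningful. *)
Definition is_distribution sigma : Prop :=
  (forall (a : R) phi psi,
     test_function Omega phi -> test_function Omega psi ->
     sigma (fun x => a * phi x + psi x) = a * sigma phi + sigma psi) /\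
  (forall K : set 'rV[R]_n, compact K -> K `<=` Omega ->
     exists (C : R) (N : nat), forall phi,
       test_function Omega phi -> fsupp phi `<=` K ->
       `|sigma phi| <= C * CN_norm N phi).

Definition distr_le sigma tau : Prop := forall phi,
  test_function Omega phi -> (forall x, 0 <= phi x) -> sigma phi <= tau phi.

(* The distribution defined by a locally integrable function. *)
Definition distr_fun (g : 'rV[R]_n -> R) : ('rV[R]_n -> R) -> R :=
  fun phi => \int[lebesgue_rV]_(x in Omega) (g x * phi x).

(* The distributional divergence of a locally integrable vector field. *)
Definition distr_div (F : 'rV[R]_n -> 'rV[R]_n) : ('rV[R]_n -> R) -> R :=
  fun phi => - \int[lebesgue_rV]_(x in Omega) dotv (F x) (gradient phi x).

Definition L2loc (F : 'rV[R]_n -> 'rV[R]_n) : Prop :=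
  (forall i, measurable_fun (Omega : set (lebesgueTypeRn R n))
     (fun x : lebesgueTypeRn R n => F x ord0 i : R)) /\
  (forall K : set 'rV[R]_n, compact K -> K `<=` Omega ->
     (\int[lebesgue_rV]_(x in K) ((enorm (F x)) ^+ 2)%:E < +oo)%E).

(* Measurability is part of [elliptic_matrix_field]: the entries of A are
   Lebesgue measurable functions on Omega. *)
Definition elliptic_matrix_field (A : 'rV[R]_n -> 'M[R]_n) : Prop :=
  [/\ forall i j, measurable_fun (Omega : set (lebesgueTypeRn R n))
        (fun x : lebesgueTypeRn R n => A x i j : R),
      forall x, Omega x -> (A x)^T = A x
    & exists m M : R, [/\ 0 < m, 0 < M &
        {ae lebesgue_rV, forall x, Omega x -> forall xi : 'rV[R]_n,
           m * (enorm xi) ^+ 2 <= dotv (mulmv (A x) xi) xi /\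
           enorm (mulmv (A x) xi) <= M * enorm xi}]].

End distributions.

(* Main.v *)
(* For a test function phi >= 0 put
     q_phi(G) = <sigma, phi> + int (A G) . grad phi + int ((A G) . G) phi,
   which is convex in G and linear in phi: a field is sought with q_phi <= 0 for all
   phi at once.  Given such a field, testing with phi = h^2 and completing the square
   yields the form inequality.  Conversely, minimizing the integrand pointwise gives
     inf_G q_phi(G) = <sigma, phi> - int (A grad sqrt phi) . grad sqrt phi,
   which is <= 0 by the form inequality for h = sqrt phi (suitably regularized).  A
   minimax argument satisfies finitely many of these constraints simultaneously, up
   to any delta > 0.  The constraints at squares of cutoff functions bound G in a
   weighted L2 space, and there a family of bounded closed convex sets with the
   finite intersection property has a common point. *)
Require Import Defs.
From mathcomp Require Import all_boot all_order all_algebra.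
From mathcomp Require Import all_classical all_reals all_analysis.
From mathcomp Require Import measurable_realfun.
From mathcomp Require Import ring lra.

Set Implicit Arguments.
Unset Strict Implicit.
Unset Printing Implicit Defensive.

Import Order.TTheory GRing.Theory Num.Theory.
Import numFieldNormedType.Exports.

Local Open Scope classical_set_scope.
Local Open Scope ring_scope.

(** * Minimax and intersections of convex sets *)

(** The constraints at squares of cutoffs bound the field on each compact subset of [Omega], with
    constants that depend on the subset, so the candidates need not lie in one plain L2 space. A
    weight [w], summed from indicators of an exhaustion with coefficients small against these
    constants, merges them into the single bound 2. The unknown becomes [sqrt w] times the sought
    field, which does live in L2(Omega).

    The finite step rests on the cone structure of the test functions: a nonnegative combination of
    two constraints is again a constraint, so solving each one separately already gives the
    hypothesis of a two-function minimax.

    In the infinite step the parallelogram identity does the work of weak compactness. All sequences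
    are chosen with geometric rates: squared increments of order [16^-k] yield pointwise and L2
    limits with squared distance of order [4^-k], and these explicit rates are what closedness of
    the constraints is tested against. *)

Section minimax.
Variables (R : realType) (V : lmodType R).
Implicit Types (P : set V) (f g : V -> R).

Definition convex_set P := forall u v s, P u -> P v -> 0 <= s <= 1 ->
  P (s *: u + (1 - s) *: v).

Definition convex_on P f := forall u v s, P u -> P v -> 0 <= s <= 1 ->
  f (s *: u + (1 - s) *: v) <= s * f u + (1 - s) * f v.

Lemma convex_set_sublevel P f d : convex_set P -> convex_on P f ->
  convex_set [set v | P v /\ f v <= d].
Proof.
move=> cP cf u v s [Pu fu] [Pv fv] s01; split; first exact: cP.
by apply: le_trans (cf _ _ _ Pu Pv s01) _; case/andP: s01 => s0 s1; nra.
Qed.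

(* If no [v] satisfies both constraints, each [v] makes the weighted sum
   negative only for weights [t] on one side of a threshold, and convexity
   separates the two kinds of thresholds; the supremum of the lower kind is
   then a weight that no [v] serves. *)
Lemma minimax2 P f g : convex_set P -> convex_on P f -> convex_on P g ->
  (forall s t d, 0 <= s -> 0 <= t -> 0 < d ->
     exists2 v, P v & s * f v + t * g v <= d) ->
  forall d, 0 < d -> exists v, [/\ P v, f v <= d & g v <= d].
Proof.
move=> cP cf cg H d d0; apply: contrapT => none.
have no v : P v -> f v <= d -> d < g v.
  by move=> Pv fv; rewrite ltNge; apply/negP => gv; apply: none; exists v.
pose L t v := (1 - t) * (f v - d) + t * (g v - d).
(* The weights add up to 1, so slack [d / 2] in the weighted sum leaves [L t] at most [- d / 2]. *)
have HL t : 0 <= t <= 1 -> exists2 v, P v & L t v < 0.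
  case/andP=> t0 t1; have [|||v Pv hv] := H (1 - t) t (d / 2); try lra.
  by exists v => //; rewrite /L; nra.
pose E := [set t | 0 <= t <= 1 /\ exists v, [/\ P v, f v <= d & L t v < 0]].
have E0 : E 0.
  split; first lra.
  have [|v Pv Lv] := HL 0; first lra.
  by exists v; split => //; move: Lv; rewrite /L; lra.
have ubE : has_ubound E by exists 1 => t [/andP[]].
have hE : has_sup E by split => //; exists 0.
set t := sup E.
have t0 : 0 <= t by exact: ub_le_sup.
have t1 : t <= 1 by apply: ge_sup => [|s [/andP[]]]//; exists 0.
have [|v Pv Lv] := HL t; first lra.
have [fv|fv] := leP (f v) d.
  have gv := no v Pv fv.
  have lt1 : t < 1.
    by rewrite lt_neqAle t1 andbT; apply/eqP => t1'; move: Lv; rewrite /L t1'; lra.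
  have D0 : 0 < g v - f v by lra.
  (* A witness with [f v <= d] at [t] would still serve at [t + e], against the choice of [t]: this
     [e] uses up at most half of the negativity of [L t v] and stays within the unit interval. *)
  pose e := Num.min (1 - t) (- L t v / (2 * (g v - f v))).
  have e0 : 0 < e by rewrite /e lt_min; apply/andP; split; [lra|apply: divr_gt0; lra].
  have e1 : e <= 1 - t by rewrite /e ge_min lexx.
  have e2 : e * (2 * (g v - f v)) <= - L t v.
    by rewrite -ler_pdivlMr ?/e ?ge_min ?lexx ?orbT//; lra.
  have : E (t + e).
    split; first lra.
    exists v; split => //.
    have -> : L (t + e) v = L t v + e * (g v - f v) by rewrite /L; ring.
    nra.
  by move=> /(ub_le_sup ubE); rewrite -/t; lra.
have gv : g v <= d.
  by rewrite leNgt; apply/negP => gv; move: Lv; rewrite /L; nra.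
have tgt0 : 0 < t.
  by rewrite lt_neqAle t0 andbT; apply/eqP => t0'; move: Lv; rewrite /L -t0'; lra.
have D0 : 0 < f v - g v by lra.
(* Moving back from [t] by less than [e] keeps [L] negative at [v]; some [t'] of [E] is that close,
   and its witness [u] lies on the other side, [f u <= d]. *)
pose e := - L t v / (f v - g v).
have e0 : 0 < e by apply: divr_gt0; lra.
have [t' [/andP[t'0 t'1] [u [Pu fu Lu]]] tt'] := sup_adherent e0 hE.
have t't : t' <= t by apply: ub_le_sup => //; split; [lra|exists u].
have gu := no u Pu fu.
have eE : e * (f v - g v) = - L t v by rewrite /e mulfVK//; lra.
have Lv' : L t' v < 0.
  have -> : L t' v = L t v + (t - t') * (f v - g v) by rewrite /L; ring.
  rewrite -/t in tt'; nra.
have t'p : 0 < t' by move: Lv'; rewrite /L; nra.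
pose a := f v - d; pose b := d - f u.
have a0 : 0 < a by rewrite /a; lra.
have b0 : 0 <= b by rewrite /b; lra.
(* The weight at which the interpolated value of [f] between [u] and [v] is exactly [d]; there the
   [f] part of [L t'] cancels, and its negativity bounds the interpolated value of [g]. *)
pose s := a / (a + b).
have sE : s * (a + b) = a by rewrite /s mulfVK//; lra.
have s0 : 0 <= s by rewrite /s divr_ge0//; lra.
have s1 : s <= 1 by rewrite /s ler_pdivrMr; lra.
have s01 : 0 <= s <= 1 by lra.
have Fz : s * (f u - d) + (1 - s) * (f v - d) = 0.
  by transitivity (a - s * (a + b)); [rewrite /a /b; ring|lra].
have : s * L t' u + (1 - s) * L t' v < 0.
  have [->|s0'] := eqVneq s 0; first lra.
  have : 0 < s by rewrite lt_def s0'.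
  nra.
have -> : s * L t' u + (1 - s) * L t' v = (1 - t') *
   (s * (f u - d) + (1 - s) * (f v - d)) + t' * (s * g u + (1 - s) * g v - d).
  by rewrite /L; ring.
rewrite Fz mulr0 add0r pmulr_rlt0// => G0.
apply: none; exists (s *: u + (1 - s) *: v); split; first exact: cP.
  by apply: le_trans (cf _ _ _ Pu Pv s01) _; lra.
by apply: le_trans (cg _ _ _ Pu Pv s01) _; lra.
Qed.

(** Induction on [F] for all convex [P] at once: a treated constraint is absorbed into [P] as a
    sublevel set. Closure of [Phi] under nonnegative combinations turns a weighted sum of two
    constraints into a single one, whose solvability is assumed; this is what [minimax2] asks
    for. *)
Lemma minimax_seq (I : eqType) (Phi : set I) (q : I -> V -> R) P :
  Phi !=set0 ->
  (forall i j s t, Phi i -> Phi j -> 0 <= s -> 0 <= t ->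
     exists2 k, Phi k & forall v, P v -> q k v = s * q i v + t * q j v) ->
  convex_set P -> (forall i, Phi i -> convex_on P (q i)) ->
  (forall i d, Phi i -> 0 < d -> exists2 v, P v & q i v <= d) ->
  forall (F : seq I) d, {in F, forall i, Phi i} -> 0 < d ->
  exists2 v, P v & {in F, forall i, q i v <= d}.
Proof.
move=> [i0 Phi0] comb cP cq H F d PhiF d0.
elim: F P comb cP cq H PhiF => [|j F IH] P comb cP cq H PhiF.
  by have [v Pv _] := H _ _ Phi0 d0; exists v.
have Phij : Phi j by apply: PhiF; rewrite inE eqxx.
have [|||||v [Pv qv] qF] := IH [set v | P v /\ q j v <= d].
- move=> i k s t Phii Phik s0 t0; have [l Phil ql] := comb i k s t Phii Phik s0 t0.
  by exists l => // v [Pv _]; exact: ql.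
- exact/convex_set_sublevel/cq.
- by move=> i Phii u v s [Pu _] [Pv _]; exact: cq.
- move=> i d' Phii d'0.
  have m0 : 0 < Num.min d d' by rewrite lt_min d0.
  have [|u [Pu fu gu]] := minimax2 cP (cq _ Phij) (cq _ Phii) _ m0.
    move=> s t e s0 t0 e0; have [k Phik qk] := comb j i s t Phij Phii s0 t0.
    by have [v Pv qv] := H _ _ Phik e0; exists v => //; rewrite -qk.
  exists u; [split => //|].
    by apply: le_trans fu _; rewrite ge_min lexx.
  by apply: le_trans gu _; rewrite ge_min lexx orbT.
- by move=> i iF; apply: PhiF; rewrite inE iF orbT.
exists v => // i; rewrite inE => /predU1P[->//|]; exact: qF.
Qed.

End minimax.

Section convex_fip.
Variables (R : realType) (V : lmodType R) (P : set V) (N : V -> R).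
Variables (I : eqType) (Phi : set I) (q : I -> V -> R).

Let feasible (F : seq I) d v := P v /\ {in F, forall i, q i v <= d}.

Let feasibleW (F F' : seq I) d d' v : {subset F <= F'} -> d' <= d ->
  feasible F' d' v -> feasible F d v.
Proof.
by move=> FF' d'd [Pv qv]; split => // i /FF' iF; exact: le_trans (qv i iF) _.
Qed.

(* The distance of the origin to the feasible sets increases along them;
   almost minimal elements form a Cauchy sequence by the parallelogram
   identity, and its limit does not change when a constraint is added. *)
Lemma convex_fip B :
  convex_set P -> (forall i, Phi i -> convex_on P (q i)) ->
  (forall v, P v -> 0 <= N v) ->
  (forall u v, P u -> P v ->
     N (u - v) = 2 * N u + 2 * N v - 4 * N (2^-1 *: u + (1 - 2^-1) *: v)) ->
  (forall u v w, P u -> P v -> P w ->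
     N (u - w) <= 2 * N (u - v) + 2 * N (v - w)) ->
  (forall u : nat -> V, (forall k, P (u k)) ->
     (forall k, N (u k.+1 - u k) <= 8 * 16^-1 ^+ k) ->
     exists2 v, P v & exists C : R, forall k, N (u k - v) <= C * 4^-1 ^+ k) ->
  (forall i (u : nat -> V) v (C : R), Phi i -> (forall k, P (u k)) -> P v ->
     (forall k, N (u k - v) <= C * 4^-1 ^+ k) ->
     (forall k, q i (u k) <= k.+1%:R^-1) -> q i v <= 0) ->
  (forall (F : seq I) (d : R), {in F, forall i, Phi i} -> 0 < d ->
     exists2 v, P v & N v <= B /\ {in F, forall i, q i v <= d}) ->
  exists2 v, P v & forall i, Phi i -> q i v <= 0.
Proof.
move=> cP cq N0 par tri complete lsc feas.
(* The supremum [m] of these lower bounds stands in for the minimum of [N] on the full intersection,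
   which is not yet known to be nonempty. *)
pose E := [set r | exists (F : seq I) (d : R), [/\ {in F, forall i, Phi i}, 0 < d &
  forall v, feasible F d v -> r <= N v]].
have E0 : E 0 by exists [::], 1; split => // v [/N0].
have ubE : has_ubound E.
  exists B => r [F [d [PhiF d0 rN]]].
  by have [v Pv [NB qv]] := feas F d PhiF d0; apply: le_trans NB; exact: rN.
have hE : has_sup E by split => //; exists 0.
set m := sup E.
have p16 k : 0 < 16^-1 ^+ k :> R by apply: exprn_gt0; rewrite invr_gt0.
have near (F : seq I) (d e : R) : {in F, forall i, Phi i} -> 0 < d -> 0 < e ->
    exists2 v, feasible F d v & N v <= m + e.
  move=> PhiF d0 e0; apply: contrapT => no.
  have : E (m + e).
    exists F, d; split => // v Fv; rewrite leNgt; apply/negP => Nv.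
    by apply: no; exists v => //; exact: ltW.
  by move=> /(ub_le_sup ubE); rewrite -/m; lra.
have far k : exists Fd : seq I * R, [/\ (forall i, i \in Fd.1 -> Phi i), 0 < Fd.2 &
    forall v, feasible Fd.1 Fd.2 v -> m - 16^-1 ^+ k <= N v].
  have [r [F [d [PhiF d0 rN]]] mr] := sup_adherent (p16 k) hE.
  by exists (F, d); split => // v /rN; rewrite -/m in mr *; lra.
have {far} [FD FDP] := choice far.
(* Families accumulate and tolerances decrease, so stage [k] inherits every earlier lower bound; its
   tolerance is moreover at most [1 / (k + 1)]. *)
pose G := fix G k := if k is k'.+1 then (FD k).1 ++ G k' else (FD 0).1.
pose D := fix D k := if k is k'.+1 then
  Num.min (Num.min (FD k).2 (D k')) k.+1%:R^-1 else Num.min (FD 0).2 1.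
have PhiG k : {in G k, forall i, Phi i}.
  elim: k => [|k IH] i /=; first by have [+ _ _] := FDP 0; apply.
  by rewrite mem_cat => /orP[|/IH//]; have [+ _ _] := FDP k.+1; apply.
have D0 k : 0 < D k.
  elim: k => [|k IH] /=.
    by rewrite lt_min ltr01 andbT; have [] := FDP 0.
  by rewrite !lt_min IH invr_gt0 ltr0Sn !andbT; have [] := FDP k.+1.
have DV k : D k <= k.+1%:R^-1.
  by case: k => [|k]; rewrite /= ge_min ?invr1 lexx orbT.
have DS k : D k.+1 <= D k by rewrite /= !ge_min lexx orbT.
have GS k : {subset G k <= G k.+1} by move=> i iG; rewrite /= mem_cat iG orbT.
have GF k v : feasible (G k) (D k) v -> m - 16^-1 ^+ k <= N v.
  move=> Gv; have [_ _] := FDP k; apply; apply: feasibleW Gv.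
    by case: k => // k i iF; rewrite /= mem_cat iF.
  by case: k => [|k]; rewrite /= !ge_min lexx.
(* The midpoint is feasible as well, so its [N] is at least [m - 16^-k]; the parallelogram identity
   then leaves [4 (m + 16^-k) - 4 (m - 16^-k)]. *)
have mid k u v : feasible (G k) (D k) u -> feasible (G k) (D k) v ->
    N u <= m + 16^-1 ^+ k -> N v <= m + 16^-1 ^+ k -> N (u - v) <= 8 * 16^-1 ^+ k.
  move=> [Pu qu] [Pv qv] Nu Nv; rewrite par//.
  have h01 : 0 <= (2^-1 : R) <= 1 by lra.
  suff /GF : feasible (G k) (D k) (2^-1 *: u + (1 - 2^-1) *: v) by lra.
  split; first exact: cP.
  move=> i iG; apply: le_trans (cq _ (PhiG _ _ iG) _ _ _ Pu Pv h01) _.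
  by have := qu _ iG; have := qv _ iG; lra.
have /choice[u uP] k : exists v, feasible (G k) (D k) v /\ N v <= m + 16^-1 ^+ k.
  by have [v] := near _ _ _ (PhiG k) (D0 k) (p16 k); exists v.
have Pu k : P (u k) by have [[]] := uP k.
have p16S k : 16^-1 ^+ k.+1 <= 16^-1 ^+ k :> R.
  by rewrite exprS; have := p16 k; lra.
have [v Pv [C uv]] : exists2 v, P v & exists C : R, forall k, N (u k - v) <= C * 4^-1 ^+ k.
  apply: complete => // k; have [Fk Nk] := uP k; have [Fk1 Nk1] := uP k.+1.
  apply: mid => //; first exact: feasibleW Fk1.
  by apply: le_trans Nk1 _; rewrite lerD2l.
exists v => // i Phii.
(* Almost minimal elements for [i :: G k] are also almost minimal for [G k], hence close to [u k] by
   [mid]. The constant [16 + 2 * C] below collects the two distances in [tri]. *)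
have /choice[w wP] k : exists v, feasible (i :: G k) (D k) v /\ N v <= m + 16^-1 ^+ k.
  have [|v' ] := near (i :: G k) _ _ _ (D0 k) (p16 k); last by exists v'.
  by move=> j; rewrite inE => /predU1P[->//|/PhiG].
have Pw k : P (w k) by have [[]] := wP k.
apply: (lsc i w v (16 + 2 * C)) => // k.
  apply: le_trans (tri _ _ _ (Pw k) (Pu k) Pv) _.
  have wu : N (w k - u k) <= 8 * 16^-1 ^+ k.
    have [Fk Nk] := uP k; have [Wk NWk] := wP k; apply: mid => //.
    by apply: feasibleW Wk => // j jG; rewrite inE jG orbT.
  have : 16^-1 ^+ k <= 4^-1 ^+ k :> R.
    by apply: lerXn2r; rewrite ?nnegrE; lra.
  by have := uv k; nra.
have [[_ qw] _] := wP k.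
by apply: le_trans (DV k); apply: qw; rewrite inE eqxx.
Qed.

End convex_fip.

(** * Smooth functions *)

Section flat_exponential.
Variable R : realType.

(* The case k = 0 is the classical flat function; the family over k is stable
   under differentiation up to linear combinations. *)
Definition flat_exp (k : nat) (t : R) : R :=
  if 0 < t then t^-1 ^+ k * expR (- t^-1) else 0.

Lemma flat_exp_gt0 k t : 0 < t -> 0 < flat_exp k t.
Proof.
by move=> t0; rewrite /flat_exp t0 mulr_gt0 ?expR_gt0// exprn_gt0// invr_gt0.
Qed.

Lemma flat_exp_le0 k t : t <= 0 -> flat_exp k t = 0.
Proof. by rewrite /flat_exp leNgt => /negbTE ->. Qed.

Lemma flat_exp_ge0 k t : 0 <= flat_exp k t.
Proof.
by have [/flat_exp_le0->//|/(flat_exp_gt0 k)/ltW] := leP t 0.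
Qed.

(** With [s = 1 / t] this is [s ^ (k + 1) <= (k + 1)! * e ^ s], one term of the exponential series.
    The bound controls the difference quotients at 0. *)
Lemma flat_exp_le k t : flat_exp k t <= k.+1`!%:R * `|t|.
Proof.
have [t0|t0] := leP t 0; first by rewrite flat_exp_le0// mulr_ge0.
rewrite /flat_exp t0 gtr0_norm//.
have s0 : 0 < t^-1 by rewrite invr_gt0.
have f0 : 0 < k.+1`!%:R :> R by rewrite ltr0n fact_gt0.
have := expR_ge1Dxn k (ltW s0).
rewrite expRN ler_pdivrMr ?expR_gt0// => h.
have : t^-1 ^+ k.+1 <= k.+1`!%:R * expR t^-1 by rewrite -ler_pdivrMl// mulrC; lra.
by rewrite exprS -ler_pdivlMl// invrK => /le_trans; apply; rewrite mulrCA mulrA.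
Qed.

(** At 0 the difference quotient of [flat_exp k] is [flat_exp k.+1] on the positive side and 0 on
    the negative one, and it tends to 0 by the linear bound. *)
Lemma is_derive_flat_exp k (t : R) :
  is_derive t 1 (flat_exp k) (flat_exp k.+2 t - k%:R * flat_exp k.+1 t).
Proof.
have [t0|t0|->] := ltgtP t 0.
- have z m : flat_exp m t = 0 by rewrite flat_exp_le0// ltW.
  rewrite !z mulr0 subr0; apply: (@near_eq_is_derive _ _ _ (fun=> 0)).
    near=> x; rewrite flat_exp_le0// ltW//; near: x.
    by exists (- t) => /=; [lra|move=> y /ltr_distlCDr /=; lra].
- have tn0 : t != 0 by rewrite gt_eqF.
  have inv : is_derive t 1 (fun x : R => x^-1) (- t ^- 2).
    split; first exact: derivableV.
    by rewrite deriveV// derive_id [LHS]mulr1.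
  pose F (y : R) := y ^+ k * expR (- y).
  have dF : is_derive t^-1 1 F
      (k%:R * t^-1 ^+ k.-1 * expR (- t^-1) - t^-1 ^+ k * expR (- t^-1)).
    have d1 : is_derive t^-1 1 (fun y : R => y ^+ k) (k%:R * t^-1 ^+ k.-1).
      by split; [exact: exprn_derivable|rewrite exp_derive scaler1].
    have d2 : is_derive t^-1 1 (fun y : R => expR (- y)) (- expR (- t^-1)).
      by rewrite -mulrN1; apply: (@is_derive1_comp _ expR -%R).
    apply: (is_derive_eq (is_deriveM d1 d2)).
    by rewrite /GRing.scale /=; ring.
  apply: (@near_eq_is_derive _ _ _ (F \o (fun x => x^-1))).
    near=> x; rewrite /F/= /flat_exp ifT//; near: x.
    by exists t => //= y /ltr_distlBl; lra.
  apply: (is_derive_eq (is_derive1_comp dF inv)); rewrite /flat_exp t0 -exprVn.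
  by case: k @F dF => [|k] F dF /=; rewrite !exprS; ring.
- rewrite !flat_exp_le0// mulr0 subr0.
  have C0 : 0 < k.+2`!%:R :> R by rewrite ltr0n fact_gt0.
  have lim0 :
      (fun h : R => h^-1 *: (flat_exp k (h + 0) - flat_exp k 0)) @ 0^' --> (0 : R).
    apply/cvgr0Pnorm_le => _/posnumP[eps]; near=> h.
    have hC : k.+2`!%:R * `|h| <= eps%:num.
      rewrite mulrC -ler_pdivlMr// ltW//; near: h.
      exists (eps%:num / k.+2`!%:R) => /=; first exact: divr_gt0.
      by move=> y /=; rewrite sub0r normrN.
    apply: le_trans hC; apply: le_trans (flat_exp_le k.+1 h).
    rewrite addr0 (flat_exp_le0 _ (lexx _)) subr0.
    have [h0|h0] := leP h 0; first by rewrite !flat_exp_le0// scaler0 normr0.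
    rewrite /flat_exp h0 scalerA -exprS ger0_norm// mulr_ge0 ?expR_ge0//.
    by rewrite exprn_ge0// invr_ge0 ltW.
  have E : (fun h : R => h^-1 *: ((flat_exp k \o shift 0) (h *: 1) - flat_exp k 0)) =
      (fun h : R => h^-1 *: (flat_exp k (h + 0) - flat_exp k 0)).
    by apply/funext => h /=; rewrite [h *: 1]mulr1.
  split; rewrite /derivable /derive E; first by apply/cvg_ex; exists 0.
  exact: cvg_lim.
Unshelve. all: by end_near. Qed.

End flat_exponential.

Section smooth_functions.
Variables (R : realType) (n : nat).
Local Notation V := 'rV[R]_n.
Local Notation e i := (delta_mx ord0 i : V).
Implicit Types (f g : V -> R).

(** A directional derivative is a derivative along a line, which gives access to the one-variable
    chain rule. *)
Lemma is_derive_line f x v df :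
  is_derive x v f df <-> is_derive (0 : R) 1 (fun h : R => f (h *: v + x)) df.
Proof.
have E : 'D_v f x = 'D_1 (fun h : R => f (h *: v + x)) 0.
  rewrite /derive; set g1 := fun h => h^-1 *: _; set g2 := fun h => h^-1 *: _.
  suff -> : g1 = g2 by [].
  by rewrite funeqE /g1 /g2 => h /=; rewrite addr0 scale0r add0r [_%:A]mulr1.
split=> -[H1 <-].
  by split; [exact: (derivable1P f x v).1|rewrite -E].
by split; [exact: (derivable1P f x v).2|rewrite E].
Qed.

Lemma is_derive_comp1 f (g : R -> R) x v df dg :
  is_derive x v f df -> is_derive (f x) 1 g dg ->
  is_derive x v (fun y => g (f y)) (dg * df).
Proof.
move=> /is_derive_line Hf Hg; apply/is_derive_line.
have Hg' : is_derive (f (0 *: v + x)) 1 g dg by rewrite scale0r add0r.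
exact: (is_derive1_comp Hg' Hf).
Qed.


(* Stable under partial derivatives, hence it contains only smooth functions. *)
Inductive smooth_closure : (V -> R) -> Prop :=
| Sm_smooth f : smooth f -> smooth_closure f
| Sm_cst c : smooth_closure (fun=> c)
| Sm_coord i : smooth_closure (fun x => x ord0 i)
| Sm_add f g : smooth_closure f -> smooth_closure g ->
    smooth_closure (fun x => f x + g x)
| Sm_mul f g : smooth_closure f -> smooth_closure g ->
    smooth_closure (fun x => f x * g x)
| Sm_inv f : smooth_closure f -> (forall x, f x != 0) ->
    smooth_closure (fun x => (f x)^-1)
| Sm_sqrt f : smooth_closure f -> (forall x, 0 < f x) ->
    smooth_closure (fun x => Num.sqrt (f x))
| Sm_flat k f : smooth_closure f -> smooth_closure (fun x => flat_exp k (f x)).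

(** The derivative of each constructor is written with constructors again. Differentiating
    [flat_exp k] raises the index by up to two, hence the constructor for all [k]. *)
Lemma smooth_closure_derive f i : smooth_closure f ->
  exists2 g, smooth_closure g & forall x, is_derive x (e i) f (g x).
Proof.
elim=> {f} [f sf|c|j|f g _ [f' Sf' Hf] _ [g' Sg' Hg]|f g Sf [f' Sf' Hf] Sg [g' Sg' Hg]
  |f Sf [f' Sf' Hf] f0|f Sf [f' Sf' Hf] f0|k f Sf [f' Sf' Hf]].
- exists (pderiv i f).
    apply: Sm_smooth => s; have [] := sf (rcons s i).
    by rewrite /pderivs foldr_rcons.
  by move=> x; apply: derivableP; have [+ _] := sf [::]; apply.
- by exists (fun=> 0) => [|x]; [exact: Sm_cst|exact: is_derive_cst].
- exists (fun=> (i == j)%:R) => [|x]; first exact: Sm_cst.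
  apply/is_derive_line.
  have -> : (fun h : R => (h *: e i + x) ord0 j) = (fun h => h * (i == j)%:R + x ord0 j).
    by apply/funext => h; rewrite !mxE eqxx /= eq_sym.
  have d1 : is_derive (0 : R) 1 (fun h : R => h * (i == j)%:R) (i == j)%:R.
    apply: (is_derive_eq (is_deriveM (is_derive_id (0 : R) 1)
      (is_derive_cst ((i == j)%:R : R) (0 : R) 1))).
    by rewrite /GRing.scale /=; ring.
  have := @is_deriveD _ _ _ _ (cst (x ord0 j)) _ _ _ _ d1 (is_derive_cst _ _ _).
  by rewrite addr0.
- by exists (fun x => f' x + g' x) => [|x]; [exact: Sm_add|exact: is_deriveD].
- exists (fun x => f x * g' x + g x * f' x) => [|x].
    by apply: Sm_add; exact: Sm_mul.
  exact: is_deriveM.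
- exists (fun x => (-1 * ((f x)^-1 * (f x)^-1)) * f' x) => [|x].
    by do !apply: Sm_mul => //; [exact: Sm_cst|exact: Sm_inv..].
  split; first by apply: derivableV => //; have [] := Hf x.
  have [dfx <-] := Hf x; rewrite deriveV//.
  by rewrite /GRing.scale /= -exprVn; ring.
- exists (fun x => (2^-1 * (Num.sqrt (f x))^-1) * f' x) => [|x].
    apply: Sm_mul => //; apply: Sm_mul; first exact: Sm_cst.
    by apply: Sm_inv; [exact: Sm_sqrt|move=> x; rewrite gt_eqF// sqrtr_gt0].
  apply: is_derive_comp1 => //.
  by apply: is_derive_eq (is_derive1_sqrt (f0 x)) _; rewrite invfM.
- exists (fun x => (flat_exp k.+2 (f x) + - k%:R * flat_exp k.+1 (f x)) * f' x) => [|x].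
    apply: Sm_mul => //; apply: Sm_add; first exact: Sm_flat.
    by apply: Sm_mul; [exact: Sm_cst|exact: Sm_flat].
  by apply: is_derive_comp1 => //; rewrite mulNr; exact: is_derive_flat_exp.
Qed.

Lemma smooth_closure_continuous f : smooth_closure f -> continuous f.
Proof.
elim=> {f} [f sf|c|j|f g _ cf _ cg|f g _ cf _ cg|f _ cf f0|f _ cf _|k f _ cf] x.
- by have [_ +] := sf [::]; apply.
- exact: cst_continuous.
- exact: coord_continuous.
- exact: (@cvgD _ R _ _ _ f g _ _ (cf x) (cg x)).
- exact: (@cvgM _ _ _ _ f g _ _ (cf x) (cg x)).
- exact: (@cvgV _ _ _ _ f _ (f0 x) (cf x)).
- exact: (continuous_comp (cf x) (@sqrt_continuous _ _)).
- apply: (continuous_comp (cf x)).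
  apply/differentiable_continuous/derivable1_diffP.
  by have [] := is_derive_flat_exp k (f x).
Qed.

(** A class of continuous functions stable under partial derivatives has all iterated derivatives.
    The basic closure properties of [smooth] then amount to one constructor each. *)
Lemma smooth_closureE f : smooth f <-> smooth_closure f.
Proof.
split; first exact: Sm_smooth.
move=> Sf s; have {}Sf : smooth_closure (pderivs s f).
  elim: s => //= i s IH; have [g Sg gP] := smooth_closure_derive i IH.
  by rewrite (_ : pderiv _ _ = g)//; apply/funext => x; have [] := gP x.
split; last exact: smooth_closure_continuous.
by move=> i x; have [g _ /(_ x)[]] := smooth_closure_derive i Sf.
Qed.

Lemma smooth_is_derive f i x : smooth f -> is_derive x (e i) f (pderiv i f x).
Proof. by move=> sf; apply: derivableP; have [+ _] := sf [::]; apply. Qed.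

Lemma smooth_continuous f : smooth f -> continuous f.
Proof. by move=> sf; have [] := sf [::]. Qed.

Lemma smooth_pderiv f i : smooth f -> smooth (pderiv i f).
Proof.
by move=> sf s; have [] := sf (rcons s i); rewrite /pderivs foldr_rcons.
Qed.

Lemma smooth_cst c : smooth ((fun=> c) : V -> R).
Proof. exact/smooth_closureE/Sm_cst. Qed.

Lemma smoothD f g : smooth f -> smooth g -> smooth (fun x => f x + g x).
Proof. by move=> /Sm_smooth sf /Sm_smooth sg; exact/smooth_closureE/Sm_add. Qed.

Lemma smoothM f g : smooth f -> smooth g -> smooth (fun x => f x * g x).
Proof. by move=> /Sm_smooth sf /Sm_smooth sg; exact/smooth_closureE/Sm_mul. Qed.

Lemma smooth_flat_exp k f : smooth f -> smooth (fun x => flat_exp k (f x)).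
Proof. by move=> /Sm_smooth sf; exact/smooth_closureE/Sm_flat. Qed.

Lemma smoothV f : smooth f -> (forall x, f x != 0) -> smooth (fun x => (f x)^-1).
Proof. by move=> /Sm_smooth sf f0; exact/smooth_closureE/Sm_inv. Qed.

Lemma smooth_sqrt f : smooth f -> (forall x, 0 < f x) ->
  smooth (fun x => Num.sqrt (f x)).
Proof. by move=> /Sm_smooth sf f0; exact/smooth_closureE/Sm_sqrt. Qed.

Lemma smooth_coord i : smooth (fun x : V => x ord0 i).
Proof. exact/smooth_closureE/Sm_coord. Qed.

Lemma smooth_sum (I : Type) (s : seq I) (f : I -> V -> R) :
  (forall k, smooth (f k)) -> smooth (fun x => \sum_(k <- s) f k x).
Proof.
move=> sf; elim: s => [|k s IH].
  rewrite (_ : (fun _ => _) = fun=> 0); first exact: smooth_cst.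
  by apply/funext => x; rewrite big_nil.
rewrite (_ : (fun _ => _) = (fun x => f k x + \sum_(k <- s) f k x)).
  exact: smoothD.
by apply/funext => x; rewrite big_cons.
Qed.

Lemma smooth_prod (I : Type) (s : seq I) (f : I -> V -> R) :
  (forall k, smooth (f k)) -> smooth (fun x => \prod_(k <- s) f k x).
Proof.
move=> sf; elim: s => [|k s IH].
  rewrite (_ : (fun _ => _) = fun=> 1); first exact: smooth_cst.
  by apply/funext => x; rewrite big_nil.
rewrite (_ : (fun _ => _) = (fun x => f k x * \prod_(k <- s) f k x)).
  exact: smoothM.
by apply/funext => x; rewrite big_cons.
Qed.

Lemma gradientZD (a : R) f g x : smooth f -> smooth g ->
  gradient (fun y => a * f y + g y) x = a *: gradient f x + gradient g x.
Proof.
move=> sf sg; apply/rowP => i; rewrite !mxE.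
have df := smooth_is_derive i x sf; have dg := smooth_is_derive i x sg.
by have [] := is_deriveD (is_deriveZ a df) dg.
Qed.

Lemma gradientM f g x : smooth f -> smooth g ->
  gradient (fun y => f y * g y) x = f x *: gradient g x + g x *: gradient f x.
Proof.
move=> sf sg; apply/rowP => i; rewrite !mxE.
have df := smooth_is_derive i x sf; have dg := smooth_is_derive i x sg.
by have [] := is_deriveM df dg.
Qed.

Lemma gradient_sqrt f x : smooth f -> (forall y, 0 < f y) ->
  gradient (fun y => Num.sqrt (f y)) x = (2 * Num.sqrt (f x))^-1 *: gradient f x.
Proof.
move=> sf f0; apply/rowP => i; rewrite !mxE.
have df := smooth_is_derive i x sf.
by have [] := is_derive_comp1 df (is_derive1_sqrt (f0 x)).
Qed.

Lemma near_eq_gradient f g x : (\near x, f x = g x) ->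
  gradient f x = gradient g x.
Proof. by move=> fg; apply/rowP => i; rewrite !mxE; exact: near_eq_derive. Qed.

Lemma gradient_cst (c : R) (x : V) : gradient (fun=> c) x = 0.
Proof. by apply/rowP => i; rewrite !mxE /pderiv derive_cst. Qed.

Lemma gradient_eq0 f x : ~ fsupp f x -> gradient f x = 0.
Proof.
move=> fx; rewrite -(gradient_cst 0 x); apply: near_eq_gradient.
have : open (~` fsupp f) by apply: closed_openC; exact: closed_closure.
rewrite openE => /(_ _ fx); apply: filterS => y /= yf.
apply: contrapT => y0; apply: yf; apply: (@subset_closure _ [set x | f x != 0]).
exact/eqP.
Qed.

Lemma fsupp_eq0 f x : ~ fsupp f x -> f x = 0.
Proof.
move=> fx; apply: contrapT => x0; apply: fx.
by apply: (@subset_closure _ [set x | f x != 0]); exact/eqP.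
Qed.

End smooth_functions.

(** * Lebesgue measure on R^n *)

Section rational_cubes.
Variables (R : realType) (n : nat).
Implicit Types (U : set 'rV[R]_n) (c : 'rV[rat]_n) (r : rat).

Definition cube c r : set 'rV[R]_n :=
  [set x | forall i, `|x ord0 i - ratr (c ord0 i)| < ratr r].

Definition ccube c r : set 'rV[R]_n :=
  [set x | forall i, `|x ord0 i - ratr (c ord0 i)| <= ratr r].

Lemma compact_ccube c r : compact (ccube c r).
Proof.
have := @rV_compact R n
  (fun i => `[ratr (c ord0 i) - ratr r, ratr (c ord0 i) + ratr r]%classic).
have <- : ccube c r = [set v | forall i, (fun i =>
    `[ratr (c ord0 i) - ratr r, ratr (c ord0 i) + ratr r]%classic) i (v ord0 i)].
  by apply/seteqP; split=> x /= + i => /(_ i); rewrite in_itv/= ler_distl.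
by apply => i; exact: segment_compact.
Qed.

(** Rational centres and radii make these cubes a countable family; the closed cube inside [U] will
    carry the compact support of a bump. *)
Lemma open_cube_nbhs U x : open U -> U x ->
  exists cr : 'rV[rat]_n * rat,
    [/\ 0 < (ratr cr.2 : R), cube cr.1 cr.2 x & ccube cr.1 cr.2 `<=` U].
Proof.
rewrite openE => oU /oU /nbhs_ballP[e /= e0 xeU].
have [|r] := @rat_in_itvoo R 0 (e / 2); first by rewrite divr_gt0.
rewrite in_itv/= => /andP[r0 re].
have /choice[c cP] (i : 'I_n) :
    exists q : rat, `|x ord0 i - ratr q| < ratr r.
  have [|q] := @rat_in_itvoo R (x ord0 i - ratr r) (x ord0 i + ratr r); first lra.
  by rewrite in_itv/= => qP; exists q; rewrite distrC ltr_distl.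
exists (\row_i c i, r); split => //= [i|y yc]; first by rewrite mxE.
apply: xeU; split => // i j; rewrite (ord1 i) /ball /=.
have := yc j; have := cP j; rewrite /= mxE.
have := ler_distD (ratr (c j)) (x ord0 j) (y ord0 j).
rewrite (distrC (ratr (c j)) (y ord0 j)).
by move=> A B C; lra.
Qed.

Lemma measurable_cube c r : measurable (cube c r).
Proof.
rewrite (_ : cube c r = \bigcap_(i in [set: 'I_n]) (rV_coord i @^-1`
    `]ratr (c ord0 i) - ratr r, ratr (c ord0 i) + ratr r[)); last first.
  apply/seteqP; split=> x /= => [xc i _|xc i].
    by rewrite /= in_itv/= -ltr_distl; exact: xc.
  by have := xc i Logic.I; rewrite /= in_itv/= -ltr_distl.
apply: fin_bigcap_measurable => // i _.
rewrite -[X in measurable X]setTI; apply: measurable_rV_coord => //.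
Qed.

(** The sigma-algebra is generated by the coordinates, so open sets are reduced to boxes: [U] is the
    union of the countably many rational cubes whose closed versions it contains. *)
Lemma open_measurable_rV U : open U -> measurable U.
Proof.
move=> oU.
pose F k := if unpickle k is Some (c, r) then
  if `[< ccube c r `<=` U >] then cube c r else set0 else set0.
suff -> : U = \bigcup_k F k.
  apply: bigcupT_measurable => k; rewrite /F; case: unpickle => [[c r]|//].
  by case: ifP => _ //; exact: measurable_cube.
apply/seteqP; split=> [x Ux|x [k _]].
  have [[c r] [_ xc cU]] := open_cube_nbhs oU Ux.
  by exists (pickle (c, r)) => //; rewrite /F pickleK; case: asboolP.
rewrite /F; case: unpickle => [[c r]|//]; case: asboolP => // cU xc.
by apply: cU => i; apply/ltW/xc.
Qed.

End rational_cubes.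

Section lebesgue_rV_theory.
Variables (R : realType) (n : nat).
Local Notation T := (lebesgueTypeRn R n).
Local Notation mu := (@lebesgue_rV R n).

Lemma borel_lebesgue_measurable (B : set 'rV[R]_n) :
  measurable B -> measurable (B : set T).
Proof. by move=> mB; apply: sub_caratheodory; exact: sub_sigma_algebra. Qed.

Lemma open_lebesgue_measurable (U : set 'rV[R]_n) :
  open U -> measurable (U : set T).
Proof.
move=> oU; apply: borel_lebesgue_measurable; exact: open_measurable_rV.
Qed.

Lemma closed_lebesgue_measurable (U : set 'rV[R]_n) :
  closed U -> measurable (U : set T).
Proof.
move=> cU; rewrite -[X in measurable X]setCK; apply: measurableC.
exact/open_lebesgue_measurable/closed_openC.
Qed.

Lemma compact_lebesgue_measurable (K : set 'rV[R]_n) :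
  compact K -> measurable (K : set T).
Proof.
by move=> /compact_closed cK; apply/closed_lebesgue_measurable/cK; exact: norm_hausdorff.
Qed.

Lemma continuous_lebesgue_measurable (D : set T) (f : 'rV[R]_n -> R) :
  continuous f -> measurable_fun D (f : T -> R).
Proof.
move=> /continuousP cf; apply: (@measurable_funS _ _ _ _ setT) => //.
apply: (measurability _ (measurable_realfun.RGenOInfty.measurableE R)).
move=> _ [_ [a ->] <-]; rewrite setTI; apply: open_lebesgue_measurable; apply: cf.
exact: interval_open.
Qed.

Lemma lebesgue_rV_borel (B : set 'rV[R]_n) : measurable B ->
  mu B = borel_lebesgue_rV R n B.
Proof. by move=> mB; exact: measurable_mu_extE. Qed.

End lebesgue_rV_theory.

Definition sup_box (R : realType) (n : nat) (M : R) : set 'rV[R]_n :=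
  [set x | forall i, `|x ord0 i| <= M].

Arguments sup_box {R} n M.

(** The measure is an iterated product, so a box in dimension [n + 1] splits into an interval and a
    box in dimension [n]. *)
Lemma borel_lebesgue_sup_box (R : realType) (n : nat) (M : R) :
  measurable (sup_box n M) /\ (borel_lebesgue_rV R n (sup_box n M) < +oo)%E.
Proof.
have mB m : measurable (sup_box m M).
  rewrite (_ : sup_box m M = \bigcap_(i in [set: 'I_m]) (rV_coord i @^-1` `[- M, M])); last first.
    apply/seteqP; split=> x /= => [xc i _|xc i].
      by rewrite /= in_itv/= -ler_norml; exact: xc.
    by have := xc i Logic.I; rewrite /= in_itv/= -ler_norml.
  apply: fin_bigcap_measurable => // i _.
  rewrite -[X in measurable X]setTI; apply: measurable_rV_coord => //.
split=> //; elim: n => [|n IH].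
  by rewrite /= diracE; case: (_ \in _); rewrite ?ltey.
rewrite /= /lebesgue_rV_step /pushforward.
have -> : @rV_cons R n @^-1` sup_box n.+1 M =
    `[- M, M] `*` sup_box n M.
  apply/seteqP; split=> [[a v] /= H|[a v] /= [Ha Hv] i].
    split; first by have := H ord0; rewrite rV_cons0/= in_itv/= -ler_norml.
    by move=> i; have := H (rshift 1 i); rewrite rV_consS.
  have [j ->|j ->] := @split_ordP 1 n i; last by rewrite rV_consS; exact: Hv.
  have -> : lshift n j = ord0 by apply/val_inj; rewrite /= (ord1 j).
  by rewrite rV_cons0/= ler_norml; move: Ha; rewrite in_itv.
rewrite product_measure1E//; last exact: mB.
apply: lte_mul_pinfty => //.
  rewrite ge0_fin_numE//; apply: compact_finite_measure; exact: segment_compact.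
Qed.

Lemma compact_lebesgue_lty (R : realType) (n : nat) (K : set 'rV[R]_n) :
  compact K -> (lebesgue_rV (K : set (lebesgueTypeRn R n)) < +oo)%E.
Proof.
move=> cK; have [M [_ KM]] := compact_bounded cK.
have [mB] := borel_lebesgue_sup_box n (M + 1).
rewrite -lebesgue_rV_borel//; apply: le_lt_trans; apply: le_measure.
- by rewrite inE; exact: compact_lebesgue_measurable.
- by rewrite inE; exact: borel_lebesgue_measurable.
- move=> x Kx i; have := KM (M + 1) _ x Kx; rewrite ltrDl ltr01 => /(_ isT).
  by apply: le_trans; rewrite -[X in _ <= X]/(mx_norm x) mx_normrE; exact: (le_bigmax _ _ (ord0, i)).
Qed.

(** * Cutoff functions *)

Section test_function_algebra.
Variables (R : realType) (n : nat) (Omega : set 'rV[R]_n).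
Implicit Types (f g : 'rV[R]_n -> R).

Lemma fsupp_sub f (C : set 'rV[R]_n) : closed C -> (forall x, ~ C x -> f x = 0) ->
  fsupp f `<=` C.
Proof.
move=> cC fC; rewrite /fsupp; apply: (@subset_trans _ (closure C)).
  apply: closureS => x /= fx; apply: contrapT => /fC fx0.
  by move: fx; rewrite fx0 eqxx.
by rewrite -(iffLR (closure_id _) cC).
Qed.

Lemma fsupp_subfun f g : (forall x, f x = 0 -> g x = 0) -> fsupp g `<=` fsupp f.
Proof.
move=> fg; apply: fsupp_sub; first exact: closed_closure.
by move=> x /fsupp_eq0; exact: fg.
Qed.

Lemma test_functionW f g : test_function Omega f -> smooth g ->
  (forall x, f x = 0 -> g x = 0) -> test_function Omega g.
Proof.
move=> [sf cf fO] sg /fsupp_subfun gf; split => //; last exact: subset_trans fO.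
by apply: subclosed_compact cf gf; exact: closed_closure.
Qed.

Lemma test_functionZD (a : R) f g : test_function Omega f -> test_function Omega g ->
  test_function Omega (fun x => a * f x + g x).
Proof.
move=> [sf cf fO] [sg cg gO].
have sub : fsupp (fun x => a * f x + g x) `<=` fsupp f `|` fsupp g.
  apply: fsupp_sub; first by apply: closedU; exact: closed_closure.
  by move=> x /not_orP[/fsupp_eq0-> /fsupp_eq0->]; rewrite mulr0 addr0.
split.
- by apply: smoothD => //; apply: smoothM => //; exact: smooth_cst.
- by apply: subclosed_compact (compactU cf cg) sub; exact: closed_closure.
- by apply: subset_trans sub _; rewrite subUset.
Qed.

Lemma test_functionM f g : test_function Omega f -> smooth g ->
  test_function Omega (fun x => f x * g x).
Proof.
move=> tf sg; have [sf _ _] := tf; apply: (test_functionW tf).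
  exact: smoothM.
by move=> x ->; rewrite mul0r.
Qed.

Lemma test_function_sqr f : test_function Omega f ->
  test_function Omega (fun x => f x ^+ 2).
Proof. by move=> tf; have [sf _ _] := tf; exact: test_functionM. Qed.

Lemma test_function0 : test_function Omega (fun=> 0).
Proof.
have sub : fsupp ((fun=> 0) : 'rV[R]_n -> R) `<=` set0.
  by apply: fsupp_sub => //; exact: closed0.
split; first exact: smooth_cst.
  by apply: subclosed_compact (@compact0 _) sub; exact: closed_closure.
exact: subset_trans sub _.
Qed.

End test_function_algebra.

(** * Exhaustion of an open set by smooth cutoffs *)

Section exhaustion.
Variables (R : realType) (n : nat) (Omega : set 'rV[R]_n).
Hypothesis oOmega : open Omega.
Implicit Types (x : 'rV[R]_n) (j k : nat).

Let V := 'rV[R]_n.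

(** The usual smooth transition, 0 for [t <= 0] and 1 for [1 <= t]; the two terms of the denominator
    never vanish together. *)
Definition smooth_step (t : R) : R :=
  flat_exp 0 t * (flat_exp 0 t + flat_exp 0 (1 - t))^-1.

Let step_den_gt0 (t : R) : 0 < flat_exp 0 t + flat_exp 0 (1 - t).
Proof.
have [t0|t0] := leP t 0.
  by rewrite ltr_wpDl ?flat_exp_ge0// flat_exp_gt0; lra.
by rewrite ltr_wpDr ?flat_exp_ge0// flat_exp_gt0.
Qed.

Let cpiece k : set V :=
  if unpickle k is Some (c, r) then
    if `[< 0 < (ratr r : R) /\ ccube c r `<=` Omega >] then ccube c r else set0
  else set0.

(** A bump that is positive exactly on the open cube coded by [k]; indices that code no cube of
    positive radius inside [Omega] contribute 0. *)
Let piece k x : R :=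
  if unpickle k is Some (c, r) then
    if `[< 0 < (ratr r : R) /\ ccube c r `<=` Omega >] then
      \prod_i flat_exp 0 (ratr r ^+ 2 - (x ord0 i - ratr (c ord0 i)) ^+ 2)
    else 0
  else 0.

Let smooth_piece k : smooth (piece k).
Proof.
rewrite /piece; case: unpickle => [[c r]|]; last exact: smooth_cst.
case: asboolP => _; last exact: smooth_cst.
apply: smooth_prod => i; apply: smooth_flat_exp.
rewrite (_ : (fun _ => _) = (fun x : V => ratr r ^+ 2 + -1 *
  ((x ord0 i + - ratr (c ord0 i)) * (x ord0 i + - ratr (c ord0 i))))).
  apply: smoothD; first exact: smooth_cst.
  apply: smoothM; first exact: smooth_cst.
  by apply: smoothM; apply: smoothD; [exact: smooth_coord|exact: smooth_cst
    |exact: smooth_coord|exact: smooth_cst].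
by apply/funext => x; rewrite mulN1r expr2.
Qed.

Let piece_ge0 k x : 0 <= piece k x.
Proof.
rewrite /piece; case: unpickle => [[c r]|//]; case: asboolP => // _.
by apply: prodr_ge0 => i _; exact: flat_exp_ge0.
Qed.

Let piece_supp k x : piece k x != 0 -> cpiece k x.
Proof.
rewrite /piece /cpiece; case: unpickle => [[c r]|]; last by rewrite eqxx.
case: asboolP => [[r0 _]|]; last by rewrite eqxx.
move=> /prodf_neq0 + i => /(_ i isT).
rewrite -(ger0_norm (ltW r0)) -ler_sqr ?nnegrE// !real_normK ?num_real//.
apply: contraNle => ?; rewrite flat_exp_le0//; lra.
Qed.

Let compact_cpiece k : compact (cpiece k).
Proof.
rewrite /cpiece; case: unpickle => [[c r]|]; last exact: compact0.
by case: asboolP => _; [exact: compact_ccube|exact: compact0].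
Qed.

Let cpiece_sub k : cpiece k `<=` Omega.
Proof.
rewrite /cpiece; case: unpickle => [[c r]|]; last by [].
by case: asboolP => [[_ h]|_].
Qed.

Let piece_gt0 x : Omega x -> exists k, 0 < piece k x.
Proof.
move=> Ox; have [[c r] [/= r0 xc cO]] := open_cube_nbhs oOmega Ox.
exists (pickle (c, r)); rewrite /piece pickleK; case: asboolP => [_|[]//].
apply: prodr_gt0 => i _; apply: flat_exp_gt0.
rewrite subr_gt0 -real_normK ?num_real// ltr_sqr ?nnegrE//; last exact: ltW.
Qed.

(** The finite sum keeps the support compact; the factor [j] drives the value to infinity at every
    point of [Omega]. *)
Let level j x : R := j%:R * \sum_(0 <= k < j) piece k x.

Let level_smooth j : smooth (level j).
Proof. by apply: smoothM; [exact: smooth_cst|exact: smooth_sum]. Qed.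

Let level_ge0 j x : 0 <= level j x.
Proof. by rewrite mulr_ge0// sumr_ge0. Qed.

Let level_homo j k x : (j <= k)%N -> level j x <= level k x.
Proof.
move=> jk; apply: ler_pM => //; first exact: sumr_ge0.
  by rewrite ler_nat.
by rewrite (@big_cat_nat _ _ _ j 0 k)//= lerDl sumr_ge0.
Qed.

Let cover_piece j := \big[setU/set0]_(k < j) cpiece k.

Let level_supp j x : ~ cover_piece j x -> level j x = 0.
Proof.
move=> xj; rewrite /level big_nat big1 ?mulr0// => k /= kj.
apply: contrapT => /eqP /piece_supp xk; apply: xj.
by rewrite /cover_piece -bigcup_mkord; exists k.
Qed.

Let cover_piece_sub j : cover_piece j `<=` Omega.
Proof. by rewrite /cover_piece -bigcup_mkord; apply: bigcup_sub. Qed.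

Let level_gt1 x : Omega x -> exists j, 1 < level j x.
Proof.
move=> Ox; have [k bk] := piece_gt0 Ox.
pose N := Num.bound (piece k x)^-1.
have Nb : 1 < N%:R * piece k x.
  by rewrite -ltr_pdivrMr// div1r archi_boundP// invr_ge0.
exists (maxn N k.+1); apply: lt_le_trans Nb _; apply: ler_pM => //.
  by rewrite ler_nat leq_maxl.
rewrite (bigD1_seq k)/= ?iota_uniq//; last by rewrite mem_index_iota/= leq_maxr.
by rewrite lerDl sumr_ge0.
Qed.

(** The cutoffs are [smooth_step] of [level j], equal to 1 on the open set [U j] where the level
    exceeds 1. These sets increase to [Omega], so a finite subcover puts each compact subset inside
    one of them. *)
Lemma smooth_exhaustion : exists (eta : nat -> V -> R) (U : nat -> set V),
  [/\ forall j, test_function Omega (eta j) /\ (forall x, 0 <= eta j x),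
      forall j x, U j x -> eta j x = 1,
      forall j, open (U j) /\ U j `<=` Omega,
      forall j k, (j <= k)%N -> U j `<=` U k &
      forall K, compact K -> K `<=` Omega -> exists j, K `<=` U j].
Proof.
pose U j := [set x | 1 < level j x].
have oU j : open (U j).
  by move/continuousP: (smooth_continuous (level_smooth j)) => /(_ _ (@open_gt _ 1)).
have UO j : U j `<=` Omega.
  move=> x /= Ux; apply: contrapT => nO; move: Ux; rewrite /U/= level_supp ?ltr10//.
  by move=> /cover_piece_sub.
have UU j k : (j <= k)%N -> U j `<=` U k.
  by move=> jk x Ux; exact: lt_le_trans (level_homo x jk).
have step0 t : t <= 0 -> smooth_step t = 0.
  by move=> t0; rewrite /smooth_step flat_exp_le0 ?mul0r.
exists (fun j x => smooth_step (level j x)), U; split => //.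
- move=> j; split; last first.
    by move=> x; rewrite mulr_ge0 ?flat_exp_ge0// invr_ge0 ltW.
  have s01 : smooth (fun x => 1 + -1 * level j x).
    apply: smoothD; first exact: smooth_cst.
    by apply: smoothM; first exact: smooth_cst.
  have se : smooth (fun x => smooth_step (level j x)).
    apply: smoothM; first exact: smooth_flat_exp.
    apply: smoothV; last by move=> x; rewrite gt_eqF.
    apply: smoothD; first exact: smooth_flat_exp.
    rewrite (_ : (fun _ => _) = (fun x => flat_exp 0 (1 + -1 * level j x))).
      exact: smooth_flat_exp.
    by apply/funext => x; rewrite mulN1r.
  have cC : compact (cover_piece j) by apply: bigsetU_compact.
  have sub : fsupp (fun x => smooth_step (level j x)) `<=` cover_piece j.
    apply: fsupp_sub; first by apply: compact_closed cC; exact: norm_hausdorff.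
    by move=> x /level_supp ->; rewrite step0.
  split => //; last exact: subset_trans (@cover_piece_sub j).
  by apply: subclosed_compact cC sub; exact: closed_closure.
- move=> j x /= Ux; rewrite /smooth_step (@flat_exp_le0 _ 0 (1 - _)).
    by rewrite addr0 mulfV// gt_eqF// flat_exp_gt0// (lt_trans _ Ux).
  by rewrite subr_le0 ltW.
- move=> K cK KO; move: cK; rewrite compact_cover.
  case/(_ nat setT U) => //.
    by move=> x /KO /level_gt1[j xj]; exists j.
  move=> D _ KD; exists (\max_(i <- finmap.enum_fset D) i)%N => x /KD[i /= iD].
  by apply: UU; exact: leq_bigmax_seq.
Qed.

End exhaustion.

(** * Square integrable fields *)

Lemma nneseries_le (R : realType) (u : nat -> \bar R) (c : \bar R) :
  (forall k, (0 <= u k)%E) -> (forall m, (\sum_(0 <= k < m) u k <= c)%E) ->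
  (\sum_(k <oo) u k <= c)%E.
Proof.
move=> u0 uc; apply: lime_le; first exact: is_cvg_nneseries.
by apply: nearW => m; exact: uc.
Qed.

Lemma sum_geometric_le2 (R : realFieldType) (z : R) m : 0 <= z -> z <= 2^-1 ->
  \sum_(0 <= k < m) z ^+ k <= 2.
Proof.
(* The extra [2 * z ^+ m] pays for the next term, since [z + 2 z^2 <= 2 z] fails to be needed in
   full: [1 + 2 z <= 2]. *)
move=> z0 z1; suff : \sum_(0 <= k < m) z ^+ k + 2 * z ^+ m <= 2.
  by have := exprn_ge0 m z0; lra.
elim: m => [|m IH]; first by rewrite big_nil add0r mulr1.
rewrite big_nat_recr//= exprS; apply: le_trans IH.
by have := exprn_ge0 m z0; nra.
Qed.

(** The intervals of centre [u k] and radius [e k] are nested, because the radius halves and the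
    increment is at most the other half. The supremum of the left end points lies in all of them,
    which yields limit and rate together. *)
Lemma geometric_increments_cvg (R : realType) (u : nat -> R) (c : R) :
  (forall k, `|u k.+1 - u k| <= c * 2^-1 ^+ k) ->
  exists2 l, u @ \oo --> l & forall k, `|u k - l| <= 2 * c * 2^-1 ^+ k.
Proof.
move=> uc; pose e k := 2 * c * 2^-1 ^+ k.
have c0 : 0 <= c by have := uc 0%N; rewrite expr0 mulr1; apply: le_trans.
have e0 k : 0 <= e k.
  by apply: mulr_ge0; [rewrite mulr_ge0|apply: exprn_ge0; lra].
have eS k : e k.+1 = e k / 2 by rewrite /e exprS; lra.
have uS k : `|u k.+1 - u k| <= e k / 2 by apply: le_trans (uc k) _; rewrite /e; lra.
have ami k m : u k - e k <= u (k + m)%N - e (k + m)%N.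
  elim: m => [|m IH]; first by rewrite addn0.
  apply: le_trans IH _; have := uS (k + m)%N; rewrite addnS eS ler_norml => /andP[]; lra.
have bmi k m : u (k + m)%N + e (k + m)%N <= u k + e k.
  elim: m => [|m IH]; first by rewrite addn0.
  apply: le_trans _ IH; have := uS (k + m)%N; rewrite addnS eS ler_norml => /andP[]; lra.
have ab k m : u m - e m <= u k + e k.
  have := ami m k; have := bmi k m; rewrite (addnC m k).
  by have := e0 (k + m)%N; lra.
pose A := range (fun k => u k - e k).
have hA : has_sup A.
  by split; [exists (u 0%N - e 0%N); exists 0%N|exists (u 0%N + e 0%N) => _ [m _ <-]].
have ule k : `|u k - sup A| <= e k.
  rewrite ler_distlC; apply/andP; split.
    by apply: ub_le_sup; [exact: hA.2|exists k].
  by apply: ge_sup => [|_ [m _ <-]]; [exact: hA.1|exact: ab].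
exists (sup A) => //; apply/cvgrPdist_le => _/posnumP[eps].
have : e k @[k --> \oo] --> 0.
  rewrite -(mulr0 (2 * c)); apply: cvgM; first exact: cvg_cst.
  apply: cvg_expr.
  by rewrite ger0_norm; lra.
move/cvgrPdist_le => /(_ _ (gt0 eps)); apply: filterS => k.
rewrite sub0r normrN ger0_norm// => ek; rewrite distrC.
exact: le_trans (ule k) ek.
Qed.

(** * Limits of fast Cauchy sequences in scalar L2 *)

Section completeness.
Context d (T : measurableType d) (R : realType) (mu : {measure set T -> \bar R}).
Variables (D : set T) (mD : measurable D).

Lemma integrable_sqr_sub (f g : T -> R) : measurable_fun D f -> measurable_fun D g ->
  mu.-integrable D (EFin \o (fun x => f x ^+ 2)) ->
  mu.-integrable D (EFin \o (fun x => g x ^+ 2)) ->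
  mu.-integrable D (EFin \o (fun x => (f x - g x) ^+ 2)).
Proof.
move=> mf mg if2 ig2.
apply: (@le_integrable _ _ _ mu D mD _ (EFin \o (fun x => 2 * f x ^+ 2 + 2 * g x ^+ 2))).
- by apply/measurable_EFinP; apply: measurable_funX; exact: measurable_funB.
- move=> x _ /=; rewrite lee_fin ger0_norm ?sqr_ge0// ger0_norm.
    rewrite -subr_ge0 (_ : _ - _ = (f x + g x) ^+ 2) ?sqr_ge0//; ring.
  by rewrite addr_ge0// mulr_ge0// sqr_ge0.
- apply: (@integrableD _ _ _ mu D mD (fun x => (2 * f x ^+ 2)%:E) (fun x => (2 * g x ^+ 2)%:E)).
    exact: integrableZl if2.
  exact: integrableZl ig2.
Qed.

(* Where the weighted sum [S] of the squared increments converges, the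
   increments are dominated by the geometric sequence [2 ^- k * sqrt S]. *)
Lemma L2_fast_cauchy_cvg (f : nat -> T -> R) (C : R) :
  (forall k, measurable_fun D (f k)) ->
  mu.-integrable D (EFin \o (fun x => f 0 x ^+ 2)) ->
  (forall k, mu.-integrable D (EFin \o (fun x => (f k.+1 x - f k x) ^+ 2))) ->
  (forall k, \int[mu]_(x in D) ((f k.+1 x - f k x) ^+ 2) <= C * 16^-1 ^+ k) ->
  exists2 g : T -> R, measurable_fun D g &
    mu.-integrable D (EFin \o (fun x => g x ^+ 2)) /\
    exists C', forall k, \int[mu]_(x in D) ((f k x - g x) ^+ 2) <= C' * 4^-1 ^+ k.
Proof.
move=> mf if0 idf dfC.
have p4 k : 0 < 4 ^+ k :> R by apply: exprn_gt0; lra.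
have q4 k : 0 < 4 * 4^-1 ^+ k :> R by apply: mulr_gt0; [lra|apply: exprn_gt0; lra].
have q2 k : 0 < 2^-1 ^+ k :> R by apply: exprn_gt0; lra.
(* The weight splits the decay [16^-k] evenly: one factor [4^-k] makes the integral of [S] finite,
   the other is the pointwise rate of the squared increments. *)
pose F k x : \bar R := (4 ^+ k * (f k.+1 x - f k x) ^+ 2)%:E.
have F0 k x : (0 <= F k x)%E.
  by rewrite lee_fin; apply: mulr_ge0; [exact: ltW|exact: sqr_ge0].
have mF k : measurable_fun D (F k).
  apply/measurable_EFinP; apply: measurable_funM => //.
  by apply: measurable_funX; exact: measurable_funB.
pose S x := (\sum_(k <oo) F k x)%E.
have S0 x : (0 <= S x)%E by apply: nneseries_ge0 => k _ _; exact: F0.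
have mS : measurable_fun D S by apply: (@ge0_emeasurable_sum _ _ _ D F xpredT) => // k x _ _; exact: F0.
have iF k : (\int[mu]_(x in D) F k x <= (C * 4^-1 ^+ k)%:E)%E.
  rewrite (_ : (\int[mu]_(x in D) F k x)%E =
      (4 ^+ k * \int[mu]_(x in D) ((f k.+1 x - f k x) ^+ 2))%:E).
    rewrite lee_fin; apply: le_trans (ler_wpM2l (ltW (p4 k)) (dfC k)) _.
    rewrite mulrCA -exprMn.
    by have -> : 4 * 16^-1 = 4^-1 :> R by lra.
  rewrite EFinM fineK; last exact: (integrable_fin_num mD (idf k)).
  rewrite -ge0_integralZl_EFin//.
  - by move=> x _; rewrite lee_fin sqr_ge0.
  - by apply/measurable_EFinP; apply: measurable_funX; exact: measurable_funB.
have C0 : 0 <= C.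
  have := dfC 0%N; rewrite expr0 mulr1; apply: le_trans.
  by apply: Rintegral_ge0 => x _; rewrite sqr_ge0.
have iS : (\int[mu]_(x in D) S x <= (2 * C)%:E)%E.
  rewrite integral_nneseries//; apply: nneseries_le => [k|m]; first exact: integral_ge0.
  apply: le_trans (lee_sum _ (fun k _ => iF k)) _.
  rewrite sumEFin lee_fin -mulr_sumr mulrC ler_wpM2r//.
  by apply: sum_geometric_le2; lra.
pose E := D `&` [set x | (S x < +oo)%E].
have mE : measurable E by exact: emeasurable_fun_infty_o.
pose h k x := f k x * \1_E x.
have mh k : measurable_fun D (h k).
  by apply: measurable_funM => //; exact: measurable_funTS.
have FS k x : (F k x <= S x)%E.
  have T0 : (0 <= \sum_(0 <= j <oo | true && (j != k)) F j x)%E by apply: nneseries_ge0 => j _ _; exact: F0.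
  by rewrite /S (@nneseriesD1 _ _ k)//; apply: leeDl.
have inc k x : E x -> `|f k.+1 x - f k x| <= Num.sqrt (fine (S x)) * 2^-1 ^+ k.
  move=> [Dx Sx].
  have := FS k x; rewrite -[S x]fineK ?ge0_fin_numE//.
  rewrite lee_fin => FSx.
  have p2 : 0 < 2 ^+ k :> R by apply: exprn_gt0; lra.
  rewrite exprVn ler_pdivlMr//.
  rewrite -(ger0_norm (ltW p2)) -normrM -sqrtr_sqr ler_wsqrtr//.
  apply: le_trans FSx; rewrite exprMn -exprM mulnC exprM mulrC.
  by have -> : 2 ^+ 2 = 4 :> R by lra.
have lim x : exists l, E x -> h ^~ x @ \oo --> l /\
    forall k, (f k x - l) ^+ 2 <= 4 * 4^-1 ^+ k * fine (S x).
  have [Ex|nEx] := pselect (E x); last by exists 0.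
  have [l fl lb] := geometric_increments_cvg (fun k => inc k x Ex).
  exists l => _; split.
    rewrite (_ : h ^~ x = f ^~ x)//; apply/funext => k.
    by rewrite /h indicE mem_set// mulr1.
  move=> k; rewrite -real_normK ?num_real//.
  have B0 : 0 <= 2 * Num.sqrt (fine (S x)) * 2^-1 ^+ k.
    by apply: mulr_ge0; [rewrite mulr_ge0// sqrtr_ge0|exact: ltW].
  have := lb k; rewrite -(@ler_sqr R) ?nnegrE//.
  move=> /le_trans; apply; rewrite !exprMn sqr_sqrtr ?fine_ge0//.
  have -> : (2^-1 ^+ k) ^+ 2 = 4^-1 ^+ k :> R.
    by rewrite -exprM mulnC exprM; congr (_ ^+ _); lra.
  have -> : 2 ^+ 2 = 4 :> R by lra.
  by rewrite mulrAC.
have {lim}[g0 g0P] := choice lim.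
pose g x := g0 x * \1_E x.
have gE x : ~ E x -> g x = 0 by move=> Ex; rewrite /g indicE memNset// mulr0.
have gEE x : E x -> g x = g0 x by move=> Ex; rewrite /g indicE mem_set// mulr1.
have mg : measurable_fun D g.
  apply: (measurable_fun_cvg mh) => x Dx.
  have [Ex|nEx] := pselect (E x); first by rewrite gEE//; have [] := g0P x Ex.
  rewrite gE// (_ : h ^~ x = fun=> 0); first exact: cvg_cst.
  by apply/funext => k; rewrite /h indicE memNset// mulr0.
have bnd k : (\int[mu]_(x in D) ((f k x - g x) ^+ 2)%:E <= (8 * C * 4^-1 ^+ k)%:E)%E.
  have c0 := q4 k.
  apply: (@le_trans _ _ (\int[mu]_(x in D) ((4 * 4^-1 ^+ k)%:E * S x))%E).
    apply: ge0_le_integral => //.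
    - by move=> x _; rewrite lee_fin sqr_ge0.
    - by apply/measurable_EFinP; apply: measurable_funX; exact: measurable_funB.
    - exact: measurable_funeM.
    (* Where [S] is infinite the bound is trivial, so the inequality holds on all of [D], including
       the points where [g] was set to 0. *)
    - move=> x Dx; have [Sx|] := ltP (S x) +oo%E.
        have Ex : E x by [].
        rewrite gEE//; have [_ /(_ k)] := g0P x Ex.
        by rewrite -[in (_ * S x)%E](@fineK _ (S x)) ?ge0_fin_numE// -EFinM lee_fin.
      by rewrite leye_eq => /eqP ->; rewrite gt0_muley ?leey// lte_fin.
  rewrite (ge0_integralZl_EFin mu mD (fun x _ => S0 x) mS (ltW c0)).
  apply: (@le_trans _ _ ((4 * 4^-1 ^+ k)%:E * (2 * C)%:E)%E).
    by apply: lee_wpmul2l => //; rewrite lee_fin ltW.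
  by rewrite -EFinM lee_fin; lra.
have ifg k : mu.-integrable D (EFin \o (fun x => (f k x - g x) ^+ 2)).
  apply/integrableP; split.
    by apply/measurable_EFinP; apply: measurable_funX; exact: measurable_funB.
  rewrite (eq_integral (fun x => ((f k x - g x) ^+ 2)%:E)).
    by apply: le_lt_trans (bnd k) _; rewrite ltry.
  by move=> x _; rewrite /= ger0_norm// sqr_ge0.
exists g => //; split.
  rewrite (_ : (fun x => g x ^+ 2) = (fun x => (f 0%N x - (f 0%N x - g x)) ^+ 2)).
    by apply: integrable_sqr_sub => //; exact: measurable_funB.
  by apply/funext => x; rewrite subKr.
exists (8 * C) => k; rewrite -lee_fin fineK//; last exact: (integrable_fin_num mD (ifg k)).
Qed.

End completeness.

Section matrix_form.
Variables (R : realType) (n : nat).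
Implicit Types (A : 'M[R]_n) (u v w : 'rV[R]_n).

Lemma dotvE u v : dotv u v = (u *m v^T) ord0 ord0.
Proof. by rewrite mxE; apply: eq_bigr => i _; rewrite mxE. Qed.

Lemma dotvC u v : dotv u v = dotv v u.
Proof. by apply: eq_bigr => i _; rewrite mulrC. Qed.

Lemma dotvZDl a u v w : dotv (a *: u + v) w = a * dotv u w + dotv v w.
Proof. by rewrite !dotvE mulmxDl -scalemxAl !mxE. Qed.

Lemma dotvZDr a u v w : dotv w (a *: u + v) = a * dotv w u + dotv w v.
Proof. by rewrite dotvC dotvZDl !(dotvC w). Qed.

Lemma dotvZl a u w : dotv (a *: u) w = a * dotv u w.
Proof. by rewrite -[a *: u]addr0 dotvZDl [dotv 0 w]dotvE mul0mx mxE addr0. Qed.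

Lemma dotvZr a u w : dotv w (a *: u) = a * dotv w u.
Proof. by rewrite dotvC dotvZl dotvC. Qed.

Lemma dotvDl u v w : dotv (u + v) w = dotv u w + dotv v w.
Proof. by rewrite -[u]scale1r dotvZDl mul1r scale1r. Qed.

Lemma dotvDr u v w : dotv w (u + v) = dotv w u + dotv w v.
Proof. by rewrite dotvC dotvDl !(dotvC w). Qed.

Lemma dotv0l w : dotv 0 w = 0.
Proof. by rewrite dotvE mul0mx mxE. Qed.

Lemma dotv0r w : dotv w 0 = 0. Proof. by rewrite dotvC dotv0l. Qed.

Lemma dotv_ge0 u : 0 <= dotv u u.
Proof. by apply: sumr_ge0 => i _; rewrite -expr2 sqr_ge0. Qed.

Lemma dotv_coord u i : (u ord0 i) ^+ 2 <= dotv u u.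
Proof.
rewrite /dotv (bigD1 i)//= -expr2 lerDl; apply: sumr_ge0 => j _.
by rewrite -expr2 sqr_ge0.
Qed.

Lemma enorm_sqr u : enorm u ^+ 2 = dotv u u.
Proof. by rewrite /enorm sqr_sqrtr// dotv_ge0. Qed.

Lemma mulmvZ A a u : mulmv A (a *: u) = a *: mulmv A u.
Proof. by rewrite /mulmv -scalemxAl. Qed.

Lemma mulmvD A u v : mulmv A (u + v) = mulmv A u + mulmv A v.
Proof. by rewrite /mulmv mulmxDl. Qed.

Lemma mulmv0 A : mulmv A 0 = 0. Proof. by rewrite /mulmv mul0mx. Qed.

Lemma mulmv1 u : mulmv 1%:M u = u.
Proof. by rewrite /mulmv trmx1 mulmx1. Qed.

Lemma dotv_mulmv_sym A u v : A^T = A -> dotv (mulmv A u) v = dotv (mulmv A v) u.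
Proof.
by move=> sA; rewrite dotvC !dotvE /mulmv !sA trmx_mul sA mulmxA.
Qed.

Lemma dotv_mulmv_sum A u v :
  dotv (mulmv A u) v = \sum_i \sum_j A i j * (u ord0 j * v ord0 i).
Proof.
rewrite /dotv; apply: eq_bigr => i _; rewrite mxE mulr_suml; apply: eq_bigr => j _.
by rewrite mxE mulrA (mulrC (u _ _)).
Qed.

End matrix_form.

(** * Square integrable vector fields and their bilinear forms *)

Section L2.
Context d (T : measurableType d) (R : realType) (mu : {measure set T -> \bar R}).
Variables (D : set T) (mD : measurable D) (n : nat).
Implicit Types (F G H : T -> 'rV[R]_n) (f g p : T -> R).

Definition sL2 f := measurable_fun D f /\
  mu.-integrable D (EFin \o (fun x => f x ^+ 2)).

Lemma sL2M f g : sL2 f -> sL2 g -> mu.-integrable D (EFin \o (fun x => f x * g x)).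
Proof.
move=> [mf if2] [mg ig2].
apply: (@le_integrable _ _ _ mu D mD _ (EFin \o (fun x => f x ^+ 2 + g x ^+ 2))).
- by apply/measurable_EFinP; exact: measurable_funM.
- move=> x _ /=; rewrite lee_fin [leRHS]ger0_norm; last by rewrite addr_ge0 ?sqr_ge0.
  have := sqr_ge0 (f x + g x); have := sqr_ge0 (f x - g x).
  by rewrite ler_norml; nra.
- exact: (@integrableD _ _ _ mu D mD (fun x => (f x ^+ 2)%:E) (fun x => (g x ^+ 2)%:E)).
Qed.

Lemma sL2ZD a f g : sL2 f -> sL2 g -> sL2 (fun x => a * f x + g x).
Proof.
move=> Lf Lg; have [mf if2] := Lf; have [mg ig2] := Lg.
have mh : measurable_fun D (fun x => a * f x + g x).
  by apply: measurable_funD => //; exact: measurable_funM.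
split=> //.
rewrite (_ : _ \o _ = (fun x => (a ^+ 2)%:E * (f x ^+ 2)%:E + ((2 * a)%:E * (f x * g x)%:E + (g x ^+ 2)%:E))%E).
  apply: integrableD => //; first exact: integrableZl.
  apply: integrableD => //; apply: integrableZl => //; exact: sL2M.
by apply/funext => x /=; rewrite -!EFinM -!EFinD; congr EFin; ring.
Qed.

Lemma sL2_bounded f g C : measurable_fun D f -> sL2 g ->
  (forall x, D x -> `|f x| <= C * `|g x|) -> sL2 f.
Proof.
move=> mf [mg ig2] fg; split => //.
apply: (@le_integrable _ _ _ mu D mD _ (EFin \o (fun x => C ^+ 2 * g x ^+ 2))).
- by apply/measurable_EFinP; exact: measurable_funX.
- move=> x Dx /=; rewrite lee_fin [leLHS]ger0_norm ?sqr_ge0// [leRHS]ger0_norm.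
    rewrite -[f x ^+ 2]real_normK ?num_real// -[g x ^+ 2]real_normK ?num_real//.
    have h := fg x Dx; have h0 := le_trans (normr_ge0 _) h.
    by rewrite -exprMn; apply: lerXn2r; rewrite ?nnegrE.
  by apply: mulr_ge0; exact: sqr_ge0.
- exact: (@integrableZl _ _ _ mu D mD (C ^+ 2) _ ig2).
Qed.

Definition L2 F := forall i, sL2 (fun x => F x ord0 i).

Lemma L2ZD a F G : L2 F -> L2 G -> L2 (a *: F + G).
Proof.
move=> LF LG i; rewrite (_ : (fun _ => _) =
    (fun x => a * F x ord0 i + G x ord0 i)); first exact: sL2ZD.
by apply/funext => x; rewrite !mxE.
Qed.

Lemma L20 : L2 0.
Proof.
move=> i; rewrite (_ : (fun _ => _) = fun=> 0); last by apply/funext => x; rewrite mxE.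
split; first exact: measurable_cst.
by rewrite (_ : _ \o _ = cst 0%E) ?integrable0//; apply/funext => x /=; rewrite expr0n.
Qed.

Lemma L2Z a F : L2 F -> L2 (a *: F).
Proof. by move=> LF; rewrite -[_ *: _]addr0; apply: L2ZD => //; exact: L20. Qed.

Lemma L2D F G : L2 F -> L2 G -> L2 (F + G).
Proof. by move=> LF LG; rewrite -[F]scale1r; exact: L2ZD. Qed.

Lemma L2B F G : L2 F -> L2 G -> L2 (F - G).
Proof. by move=> LF LG; rewrite addrC -scaleN1r; exact: L2ZD. Qed.

Lemma L2_mul p F C : measurable_fun D p -> (forall x, D x -> `|p x| <= C) ->
  L2 F -> L2 (fun x => p x *: F x).
Proof.
move=> mp pC LF i; have [mF _] := LF i.
apply: (@sL2_bounded _ (fun x => F x ord0 i) C) => // [|x Dx].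
  rewrite (_ : (fun _ => _) = fun x => p x * F x ord0 i); first exact: measurable_funM.
  by apply/funext => x; rewrite mxE.
by rewrite mxE normrM ler_wpM2r// pC.
Qed.

Section form.
Variables (A : T -> 'M[R]_n) (M : R).
Hypothesis mA : forall i j, measurable_fun D (fun x => A x i j).
Hypothesis bA : forall x i j, D x -> `|A x i j| <= M.

Definition ip F G : R := \int[mu]_(x in D) dotv (mulmv (A x) (F x)) (G x).

(** Bounded entries reduce the form to finitely many products of two square integrable scalar
    functions. *)
Lemma ip_integrable F G : L2 F -> L2 G ->
  mu.-integrable D (EFin \o (fun x => dotv (mulmv (A x) (F x)) (G x))).
Proof.
move=> LF LG.
rewrite (_ : _ \o _ = (fun x => \sum_(ij : 'I_n * 'I_n)
    (A x ij.1 ij.2 * (F x ord0 ij.2 * G x ord0 ij.1))%:E)%E); last first.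
  apply/funext => x /=; rewrite dotv_mulmv_sum sumEFin; congr EFin.
  by rewrite pair_big.
apply: integrable_sum => // ij _.
have mFG := sL2M (LF ij.2) (LG ij.1).
apply: (@le_integrable _ _ _ mu D mD _
  (EFin \o (fun x => M * (F x ord0 ij.2 * G x ord0 ij.1)))).
- apply/measurable_EFinP; apply: measurable_funM => //.
  by apply: measurable_funM; [have [] := LF ij.2|have [] := LG ij.1].
- move=> x Dx /=; rewrite lee_fin !normrM ler_wpM2r ?mulr_ge0//.
  exact: le_trans (bA _ _ Dx) (ler_norm _).
- exact: (@integrableZl _ _ _ mu D mD M _ mFG).
Qed.

Lemma eq_ip F F' G G' : (forall x, D x -> dotv (mulmv (A x) (F x)) (G x) =
  dotv (mulmv (A x) (F' x)) (G' x)) -> ip F G = ip F' G'.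
Proof. by move=> E; apply: eq_Rintegral => x /set_mem; exact: E. Qed.

Lemma ip0l G : ip 0 G = 0.
Proof.
rewrite /ip; under eq_Rintegral do rewrite mulmv0 dotv0l.
by rewrite Rintegral_cst// mul0r.
Qed.

Lemma ip0r F : ip F 0 = 0.
Proof.
rewrite /ip; under eq_Rintegral do rewrite dotv0r.
by rewrite Rintegral_cst// mul0r.
Qed.

Lemma ipZDl a F G H : L2 F -> L2 G -> L2 H ->
  ip (a *: F + G) H = a * ip F H + ip G H.
Proof.
move=> LF LG LH; have iF := ip_integrable LF LH; have iG := ip_integrable LG LH.
rewrite /ip -RintegralZl// -RintegralD//; last first.
  exact: (@integrableZl _ _ _ mu D mD a _ iF).
by apply: eq_Rintegral => x _; rewrite mulmvD mulmvZ dotvZDl.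
Qed.

Lemma ipZl a F H : L2 F -> L2 H -> ip (a *: F) H = a * ip F H.
Proof.
by move=> LF LH; rewrite -[a *: F]addr0 ipZDl// ?ip0l ?addr0//; exact: L20.
Qed.

Lemma ipZDr a F G H : L2 F -> L2 G -> L2 H ->
  ip H (a *: F + G) = a * ip H F + ip H G.
Proof.
move=> LF LG LH; have iF := ip_integrable LH LF; have iG := ip_integrable LH LG.
rewrite /ip -RintegralZl// -RintegralD//; last first.
  exact: (@integrableZl _ _ _ mu D mD a _ iF).
by apply: eq_Rintegral => x _; rewrite dotvZDr.
Qed.

Lemma ipZr a F H : L2 F -> L2 H -> ip H (a *: F) = a * ip H F.
Proof.
by move=> LF LH; rewrite -[a *: F]addr0 ipZDr// ?ip0r ?addr0//; exact: L20.
Qed.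

Lemma ipC F G : (forall x, D x -> (A x)^T = A x) -> ip F G = ip G F.
Proof.
by move=> sA; apply: eq_Rintegral => x /set_mem /sA; exact: dotv_mulmv_sym.
Qed.

Lemma le_ip F G F' G' : L2 F -> L2 G -> L2 F' -> L2 G' ->
  (forall x, D x -> dotv (mulmv (A x) (F x)) (G x) <=
    dotv (mulmv (A x) (F' x)) (G' x)) -> ip F G <= ip F' G'.
Proof.
by move=> LF LG LF' LG' le; apply: le_Rintegral => //; exact: ip_integrable.
Qed.

End form.
End L2.

Lemma Rintegral_sum d (T : measurableType d) (R : realType)
    (mu : {measure set T -> \bar R}) (D : set T) (I : Type) (s : seq I)
    (f : I -> T -> R) : measurable D ->
  (forall i, mu.-integrable D (EFin \o f i)) ->
  \int[mu]_(x in D) (\sum_(i <- s) f i x) = \sum_(i <- s) \int[mu]_(x in D) f i x.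
Proof.
move=> mD iF; elim: s => [|i s IH].
  rewrite big_nil; under eq_Rintegral do rewrite big_nil.
  by rewrite Rintegral_cst// mul0r.
rewrite big_cons -IH -RintegralD//.
  by apply: eq_Rintegral => x _; rewrite big_cons.
rewrite (_ : _ \o _ = (fun x => \sum_(j <- s) (f j x)%:E)%E).
  by apply: integrable_sum => // j _; exact: iF.
by apply/funext => x /=; rewrite sumEFin.
Qed.

(** * The Hilbert space of square integrable fields *)

Section L2_hilbert.
Context d (T : measurableType d) (R : realType) (mu : {measure set T -> \bar R}).
Variables (D : set T) (mD : measurable D) (n : nat).
Implicit Types (F G H : T -> 'rV[R]_n).
Local Notation L2 := (@L2 _ T R mu D n).

Let one : T -> 'M[R]_n := fun=> 1%:M.

Let m1 i j : measurable_fun D (fun x => one x i j).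
Proof. exact: measurable_cst. Qed.

Let b1 x i j : D x -> `|one x i j| <= 1.
Proof. by move=> _; rewrite mxE; case: (i == j); rewrite ?normr1 ?normr0. Qed.

(** Taken as a case of [ip], so that bilinearity is proved once for norm and energy. *)
Definition L2sqr F : R := ip mu D one F F.

Lemma L2sqrE F : L2sqr F = \int[mu]_(x in D) dotv (F x) (F x).
Proof. by apply: eq_Rintegral => x _; rewrite mulmv1. Qed.

Lemma L2sqr_ge0 F : 0 <= L2sqr F.
Proof. by rewrite L2sqrE; apply: Rintegral_ge0 => x _; exact: dotv_ge0. Qed.

Lemma L2sqrZD a F G : L2 F -> L2 G ->
  L2sqr (a *: F + G) = a ^+ 2 * L2sqr F + 2 * a * ip mu D one F G + L2sqr G.
Proof.
move=> LF LG; have LFG := L2ZD mD a LF LG.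
rewrite /L2sqr (ipZDl mD m1 b1)// !(ipZDr mD m1 b1)//.
rewrite (@ipC _ _ _ mu D n one G F); last by move=> x _; rewrite trmx1.
by ring.
Qed.

Lemma L2sqrB F G : L2 F -> L2 G ->
  L2sqr (F - G) = L2sqr F - 2 * ip mu D one F G + L2sqr G.
Proof.
move=> LF LG; rewrite addrC -scaleN1r L2sqrZD// (@ipC _ _ _ mu D n one G F).
  by ring.
by move=> x _; rewrite trmx1.
Qed.

(** The midpoint is written as a convex combination, the shape in which [convex_fip] uses it. *)
Lemma L2sqr_parallelogram F G : L2 F -> L2 G ->
  L2sqr (F - G) = 2 * L2sqr F + 2 * L2sqr G -
    4 * L2sqr (2^-1 *: F + (1 - 2^-1) *: G).
Proof.
move=> LF LG; rewrite L2sqrB// L2sqrZD//; last exact: L2Z.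
rewrite -[(1 - 2^-1) *: G]addr0.
have L00 : L2 0 by exact: L20.
rewrite (ipZDr mD m1 b1)// L2sqrZD//.
rewrite !ip0r// /L2sqr ip0r//; have -> : 1 - 2^-1 = 2^-1 :> R by lra.
by lra.
Qed.

Lemma L2sqr_triangle F G H : L2 F -> L2 G -> L2 H ->
  L2sqr (F - H) <= 2 * L2sqr (F - G) + 2 * L2sqr (G - H).
Proof.
move=> LF LG LH; have L1 : L2 (F - G) by exact: L2B.
have L3 : L2 (G - H) by exact: L2B.
have -> : F - H = 1 *: (F - G) + (G - H) by rewrite scale1r addrA subrK.
rewrite L2sqrZD//; have := L2sqr_ge0 ((F - G) - (G - H)).
by rewrite L2sqrB//; lra.
Qed.

Lemma L2_coord_le F i : L2 F -> \int[mu]_(x in D) (F x ord0 i ^+ 2) <= L2sqr F.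
Proof.
move=> LF; rewrite L2sqrE; apply: le_Rintegral => //; first by have [] := LF i.
  have := ip_integrable mD m1 b1 LF LF.
  by under eq_fun do rewrite mulmv1.
by move=> x _; exact: dotv_coord.
Qed.

Lemma L2sqr_sum F : L2 F -> L2sqr F = \sum_i \int[mu]_(x in D) (F x ord0 i ^+ 2).
Proof.
move=> LF; rewrite L2sqrE -Rintegral_sum//; last by move=> i; have [] := LF i.
Qed.

(** Coordinatewise limits: [L2sqr] dominates the increments of each coordinate, and the constants of
    the finitely many coordinates add up. *)
Lemma L2_complete (u : nat -> T -> 'rV[R]_n) C : (forall k, L2 (u k)) ->
  (forall k, L2sqr (u k.+1 - u k) <= C * 16^-1 ^+ k) ->
  exists2 v, L2 v & exists C' : R, forall k, L2sqr (u k - v) <= C' * 4^-1 ^+ k.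
Proof.
move=> Lu uC.
have /choice[v vP] i : exists g : T -> R, sL2 mu D g /\
    exists C', forall k, \int[mu]_(x in D) ((u k x ord0 i - g x) ^+ 2) <= C' * 4^-1 ^+ k.
  have inc k : (fun x => (u k.+1 x ord0 i - u k x ord0 i) ^+ 2) =
     (fun x => (u k.+1 - u k) x ord0 i ^+ 2) by apply/funext => x; rewrite !mxE.
  have LB k : L2 (u k.+1 - u k) by exact: L2B.
  have [|||k|g mg [ig gC]] := @L2_fast_cauchy_cvg _ T R mu D mD (fun k x => u k x ord0 i) C.
  - by move=> k; have [] := Lu k i.
  - by have [] := Lu 0%N i.
  - by move=> k; rewrite inc; have [] := LB k i.
  - by rewrite inc; apply: le_trans (uC k); exact: L2_coord_le.
  - by exists g.
have Lv : L2 (fun x => \row_i v i x).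
  move=> i; rewrite (_ : (fun _ => _) = v i); first by have [] := vP i.
  by apply/funext => x; rewrite mxE.
exists (fun x => \row_i v i x) => //.
have /choice[c cP] i : exists c : R, forall k,
    \int[mu]_(x in D) ((u k x ord0 i - v i x) ^+ 2) <= c * 4^-1 ^+ k.
  by have [_ [c cP]] := vP i; exists c.
exists (\sum_i c i) => k; rewrite L2sqr_sum; last exact: L2B.
rewrite mulr_suml; apply: ler_sum => i _; apply: le_trans (cP i k).
by rewrite le_eqVlt; apply/orP; left; apply/eqP/eq_Rintegral => x _; rewrite !mxE.
Qed.

(** * Convex quadratic functionals on L2 *)

Section quadratic.
Variables (A : T -> 'M[R]_n) (M : R).
Hypothesis mA : forall i j, measurable_fun D (fun x => A x i j).
Hypothesis bA : forall x i j, D x -> `|A x i j| <= M.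
Hypothesis sA : forall x, D x -> (A x)^T = A x.
Hypothesis pA : forall x u, D x -> 0 <= dotv (mulmv (A x) u) u.

Local Notation ipA := (ip mu D A).

(** The functional q of the overview, with [s], [p], [F] for the value of [sigma], for [phi] and for
    its gradient. Left abstract, they also cover the weighted problem, where [F] is no longer the
    gradient of [p]. *)
Definition qf (s : R) (p : T -> R) F G :=
  s + (ipA G F + ipA (fun x => p x *: G x) G).

Definition qf_data (p : T -> R) F := [/\ L2 F, measurable_fun D p,
  forall x, D x -> 0 <= p x & exists C, forall x, D x -> p x <= C].

Let L2p p F G : qf_data p F -> L2 G -> L2 (fun x => p x *: G x).
Proof.
move=> [_ mp p0 [C pC]] LG; apply: (@L2_mul _ _ _ _ _ mD _ _ _ C) => // x Dx.
by rewrite ger0_norm ?pC// p0.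
Qed.

(** An exact second-order expansion at [G]. Its last term is nonnegative, so the rest is a
    supporting affine function; convexity and closedness both come from this. *)
Lemma qf_expand s p F G H : qf_data p F -> L2 G -> L2 H ->
  qf s p F (H + G) = qf s p F G + ipA H (F + 2 *: (fun x => p x *: G x)) +
    ipA (fun x => p x *: H x) H.
Proof.
move=> pF LG LH; have LpG := L2p pF LG; have LpH := L2p pF LH.
have LF : L2 F by case: pF.
rewrite /qf -[H in H + G]scale1r.
rewrite (ipZDl mD mA bA)//.
rewrite (_ : (fun x => p x *: (1 *: H + G) x) =
   1 *: (fun x => p x *: H x) + (fun x => p x *: G x)); last first.
  by apply/funext => x; rewrite !fctE !scale1r scalerDr.
rewrite (ipZDl mD mA bA)//; last by apply: L2ZD.
rewrite !(ipZDr mD mA bA)// [F + _]addrC (ipZDr mD mA bA)//.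
rewrite (@ipC _ _ _ mu D n A (fun x => p x *: G x) H sA).
have -> : ipA (fun x => p x *: H x) G = ipA H (fun x => p x *: G x).
  by apply: eq_ip => x _; rewrite mulmvZ dotvZl dotvZr.
by ring.
Qed.

Lemma qf_convex s p F : qf_data p F -> convex_on [set G | L2 G] (qf s p F).
Proof.
move=> pF G H t LG LH /andP[t0 t1].
pose K := G - H; have LK : L2 K by exact: L2B.
have [LF mp p0 _] := pF.
have L1K : L2 (t *: K) by exact: L2Z.
have E1 : t *: G + (1 - t) *: H = t *: K + H.
  by rewrite /K scalerBr scalerBl scale1r addrA addrAC.
have E2 : G = K + H by rewrite /K subrK.
have LpH := L2p pF LH; have LpK := L2p pF LK.
have L00 : L2 0 by exact: L20.
have L3 : L2 (F + 2 *: (fun x => p x *: H x)) by apply: L2D => //; exact: L2Z.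
rewrite E1 [in qf s p F G]E2 !(qf_expand _ pF)//.
rewrite -[t *: K]addr0 (ipZDl mD mA bA)//.
have -> : (fun x => p x *: (t *: K + 0) x) = t *: (fun x => p x *: K x) + 0.
  by apply/funext => x; rewrite !fctE !addr0 !scalerA mulrC.
have L4 : L2 (t *: K + 0) by rewrite addr0.
rewrite (ipZDl mD mA bA)// (ipZDr mD mA bA)// !ip0r// !ip0l//.
have : 0 <= ipA (fun x => p x *: K x) K.
  apply: Rintegral_ge0 => x Dx; rewrite mulmvZ dotvZl mulr_ge0 ?p0//.
  exact: pA.
set Q := ipA (fun x => p x *: K x) K; set q := qf _ _ _ _; set b := ipA K _ => Q0.
have : t * (t * Q) <= t * Q by rewrite ler_wpM2l// ler_piMl.
lra.
Qed.

(** Young's inequality entry by entry, with a parameter [tau] that is later tied to the rate of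
    convergence. *)
Lemma ip_ge (F G : T -> 'rV[R]_n) tau : 0 < tau -> L2 F -> L2 G ->
  - (`|M| * n%:R * (tau^-1 * L2sqr F + tau * L2sqr G)) <= ipA F G.
Proof.
move=> tau0 LF LG.
pose c := - (`|M| * n%:R).
have iF : mu.-integrable D (EFin \o (fun x => dotv (F x) (F x))).
  by have := ip_integrable mD m1 b1 LF LF; under eq_fun do rewrite mulmv1.
have iG : mu.-integrable D (EFin \o (fun x => dotv (G x) (G x))).
  by have := ip_integrable mD m1 b1 LG LG; under eq_fun do rewrite mulmv1.
have i1 := @integrableZl _ _ _ mu D mD tau^-1 _ iF.
have i2 := @integrableZl _ _ _ mu D mD tau _ iG.
have i3 := @integrableD _ _ _ mu D mD _ _ i1 i2.
have E : - (`|M| * n%:R * (tau^-1 * L2sqr F + tau * L2sqr G)) =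
   \int[mu]_(x in D) (c * (tau^-1 * dotv (F x) (F x) + tau * dotv (G x) (G x))).
  by rewrite RintegralZl// RintegralD// !RintegralZl// !L2sqrE mulNr.
have iE : mu.-integrable D (EFin \o (fun x => c * (tau^-1 * dotv (F x) (F x) +
    tau * dotv (G x) (G x)))).
  exact: (@integrableZl _ _ _ mu D mD c _ i3).
rewrite E; apply: le_Rintegral => //; first exact: (ip_integrable mD mA bA LF LG).
move=> x Dx; rewrite dotv_mulmv_sum.
have dE (w : 'rV[R]_n) : dotv w w = \sum_i w ord0 i ^+ 2.
  by apply: eq_bigr => i _; rewrite expr2.
have -> : c * (tau^-1 * dotv (F x) (F x) + tau * dotv (G x) (G x)) =
    \sum_i \sum_j - `|M| * (tau^-1 * (F x ord0 j) ^+ 2 + tau * (G x ord0 i) ^+ 2).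
  transitivity (\sum_(i < n) - `|M| * (tau^-1 * dotv (F x) (F x) +
      n%:R * (tau * (G x ord0 i) ^+ 2))).
    rewrite -mulr_sumr big_split/= sumr_const card_ord -!mulr_sumr -mulr_natl.
    by rewrite (dE (G x)) /c; ring.
  apply: eq_bigr => i _; rewrite -mulr_sumr big_split/= sumr_const card_ord.
  by rewrite -mulr_sumr mulr_natl dE.
apply: ler_sum => i _; apply: ler_sum => j _.
set a := F x ord0 j; set b := G x ord0 i.
have ab : `|a * b| <= tau^-1 * a ^+ 2 + tau * b ^+ 2.
  have tn0 : tau != 0 by rewrite gt_eqF.
  have h1 : 0 <= tau^-1 * (a - tau * b) ^+ 2 by rewrite mulr_ge0 ?sqr_ge0 ?invr_ge0 ?ltW.
  have h2 : 0 <= tau^-1 * (a + tau * b) ^+ 2 by rewrite mulr_ge0 ?sqr_ge0 ?invr_ge0 ?ltW.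
  have E1 : tau^-1 * (a - tau * b) ^+ 2 = tau^-1 * a ^+ 2 + tau * b ^+ 2 - 2 * (a * b) by field.
  have E2 : tau^-1 * (a + tau * b) ^+ 2 = tau^-1 * a ^+ 2 + tau * b ^+ 2 + 2 * (a * b) by field.
  by rewrite ler_norml; apply/andP; split; lra.
have : `|A x i j * (a * b)| <= `|M| * (tau^-1 * a ^+ 2 + tau * b ^+ 2).
  by rewrite normrM; apply: ler_pM => //; apply: le_trans (bA _ _ Dx) (ler_norm _).
by rewrite ler_norml mulNr => /andP[].
Qed.

(** The expansion at [v] bounds the value there by [1 / (k + 1)] minus a term linear in [u k - v],
    and [ip_ge] makes that term small. *)
Lemma qf_closed s p F (u : nat -> T -> 'rV[R]_n) v C : qf_data p F ->
  (forall k, L2 (u k)) -> L2 v ->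
  (forall k, L2sqr (u k - v) <= C * 4^-1 ^+ k) ->
  (forall k, qf s p F (u k) <= k.+1%:R^-1) -> qf s p F v <= 0.
Proof.
move=> pF Lu Lv uv qu; have [LF mp p0 _] := pF.
pose H := F + 2 *: (fun x => p x *: v x).
have LH : L2 H by apply: L2D => //; apply: L2Z => //; exact: L2p pF Lv.
pose K := `|M| * n%:R * (C + L2sqr H).
have bnd k : qf s p F v <= (1 + `|K|) * k.+1%:R^-1.
  have LD : L2 (u k - v) by exact: L2B.
  have Q : qf s p F v <= k.+1%:R^-1 - ipA (u k - v) H.
    have E : qf s p F (u k) = qf s p F ((u k - v) + v) by rewrite subrK.
    have := qu k; rewrite E qf_expand// -/H.
    have : 0 <= ipA (fun x => p x *: (u k - v) x) (u k - v).
      apply: Rintegral_ge0 => x Dx; rewrite mulmvZ dotvZl mulr_ge0 ?p0//.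
      exact: pA.
    by move=> h0 h1; rewrite lerBrDr; apply: le_trans h1; rewrite lerDl.
  have t0 : 0 < 2^-1 ^+ k :> R by apply: exprn_gt0; lra.
  have kt : 2^-1 ^+ k <= k.+1%:R^-1 :> R.
    rewrite exprVn lef_pV2 ?posrE ?ltr0n//.
    by rewrite -natrX ler_nat; exact: ltn_expl.
  (* The parameter [2^-k] balances the two terms: dividing the squared distance [4^-k] by it leaves
     [2^-k] again. *)
  have := ip_ge t0 LD LH.
  have tE : (2^-1 ^+ k)^-1 * 4^-1 ^+ k = 2^-1 ^+ k :> R.
    have -> : 4^-1 = 2^-1 * 2^-1 :> R by lra.
    by rewrite exprMn mulKf// gt_eqF.
  have : `|M| * n%:R * ((2^-1 ^+ k)^-1 * L2sqr (u k - v) + 2^-1 ^+ k * L2sqr H)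
      <= K * 2^-1 ^+ k.
    rewrite /K -[leRHS]mulrA; apply: ler_wpM2l; first exact: mulr_ge0.
    rewrite mulrDl (mulrC (L2sqr H)) lerD2r.
    apply: le_trans (ler_wpM2l _ (uv k)) _; first by rewrite invr_ge0 ltW.
    by rewrite mulrCA tE.
  have : K * 2^-1 ^+ k <= `|K| * k.+1%:R^-1.
    apply: (@le_trans _ _ (`|K| * 2^-1 ^+ k)); last exact: ler_wpM2l.
    by apply: ler_wpM2r; [exact: ltW|exact: ler_norm].
  move=> h3 h2 h1; apply: le_trans Q _; rewrite mulrDl mul1r lerD2l lerNl.
  by apply: le_trans h1; rewrite lerN2; exact: le_trans h2 h3.
rewrite leNgt; apply/negP => q0.
have K1 : 0 < 1 + `|K| by have := normr_ge0 K; lra.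
have := bnd (Num.bound ((1 + `|K|) / qf s p F v)); apply/negP; rewrite -ltNge.
rewrite ltr_pdivrMr ?ltr0n// mulrC -ltr_pdivrMr//.
apply: lt_trans (archi_boundP _) _; first by rewrite divr_ge0// ltW.
by rewrite ltr_nat.
Qed.

End quadratic.
End L2_hilbert.

(** * Test functions and weights *)

Lemma compact_support_bounded (R : realType) (n : nat) (g : 'rV[R]_n -> R)
    (K : set 'rV[R]_n) : continuous g -> compact K ->
  (forall x, ~ K x -> g x = 0) -> exists2 C, 0 <= C & forall x, `|g x| <= C.
Proof.
move=> cg cK g0; have cgK : compact (g @` K).
  by apply: continuous_compact => //; exact: continuous_subspaceT.
have [M [_ HM]] := compact_bounded cgK; exists (`|M| + 1) => [|x].
  by rewrite addr_ge0.
have [Kx|/g0 ->] := pselect (K x); last by rewrite normr0 addr_ge0.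
apply: HM; last by exists x.
by apply: le_lt_trans (ler_norm M) _; rewrite ltrDl.
Qed.

Section test_L2.
Variables (R : realType) (n : nat) (Omega : set 'rV[R]_n).
Hypothesis oOmega : open Omega.
Local Notation T := (lebesgueTypeRn R n).
Local Notation mu := (@lebesgue_rV R n).
Local Notation D := (Omega : set T).
Local Notation L2 := (@L2 _ T R mu D n).

Lemma measurable_Omega : measurable D.
Proof. exact: open_lebesgue_measurable. Qed.
Let mD := measurable_Omega.

Lemma sL2_indic (K : set 'rV[R]_n) : compact K -> sL2 mu D (\1_K : T -> R).
Proof.
move=> cK; have mK := compact_lebesgue_measurable cK.
split; first exact: measurable_indic.
rewrite (_ : _ \o _ = EFin \o (\1_K : T -> R)); last first.
  by apply/funext => x /=; rewrite indicE; case: (_ \in _); rewrite ?expr1n ?expr0n.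
apply/integrableP; split; first exact/measurable_EFinP/measurable_indic.
under eq_integral => x _ do rewrite /= ger0_norm ?indicE ?ler0n// -indicE.
rewrite integral_indic//; apply: le_lt_trans (compact_lebesgue_lty cK).
by apply: le_measure; rewrite ?inE//; exact: measurableI.
Qed.

Lemma compact_support_sL2 (g : 'rV[R]_n -> R) (K : set 'rV[R]_n) :
  continuous g -> compact K -> (forall x, ~ K x -> g x = 0) -> sL2 mu D (g : T -> R).
Proof.
move=> cg cK g0; have [C C0 gC] := compact_support_bounded cg cK g0.
apply: (sL2_bounded mD (g := \1_K) (C := C)) => [||x Dx].
- exact: continuous_lebesgue_measurable.
- exact: sL2_indic.
- rewrite indicE; have [Kx|nKx] := pselect (K x).
    by rewrite mem_set// normr1 mulr1.
  by rewrite g0// normr0 mulr_ge0.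
Qed.

Lemma test_gradient_L2 phi : test_function Omega phi -> L2 (gradient phi).
Proof.
move=> [sphi cphi _] i.
rewrite (_ : (fun _ => _) = pderiv i phi); last by apply/funext => x; rewrite mxE.
apply: (compact_support_sL2 _ cphi).
  exact/smooth_continuous/smooth_pderiv.
by move=> x /gradient_eq0 /rowP /(_ i); rewrite !mxE.
Qed.

Lemma test_bounded phi : test_function Omega phi ->
  exists2 C, 0 <= C & forall x, `|phi x| <= C.
Proof.
move=> [sphi cphi _]; apply: (compact_support_bounded _ cphi).
  exact: smooth_continuous.
by move=> x; exact: fsupp_eq0.
Qed.

Lemma test_measurable phi : smooth phi -> measurable_fun D (phi : T -> R).
Proof.
by move=> sphi; apply: continuous_lebesgue_measurable; exact: smooth_continuous.
Qed.

Lemma test_qf_data phi : test_function Omega phi -> (forall x, 0 <= phi x) ->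
  qf_data mu D (phi : T -> R) (gradient phi : T -> 'rV[R]_n).
Proof.
move=> tphi phi0; have [C _ phiC] := test_bounded tphi; split.
- exact: test_gradient_L2.
- by apply: test_measurable; case: tphi.
- by move=> x _; exact: phi0.
- by exists C => x _; exact: le_trans (ler_norm _) (phiC x).
Qed.

(** The indicator of a compact set turns a local field into a global one, to which the form lemmas
    apply. *)
Lemma L2loc_restrict (F : 'rV[R]_n -> 'rV[R]_n) (K : set 'rV[R]_n) :
  L2loc Omega F -> compact K -> K `<=` Omega ->
  L2 (fun x : T => (\1_K x : R) *: F x).
Proof.
move=> [mF iF] cK KO i; have mK := compact_lebesgue_measurable cK.
have E : (fun x : T => ((\1_K x : R) *: F x) ord0 i) = (fun x => \1_K x * F x ord0 i).
  by apply/funext => x; rewrite mxE.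
have m1 : measurable_fun D (fun x : T => ((\1_K x : R) *: F x) ord0 i).
  by rewrite E; apply: measurable_funM => //; exact: measurable_indic.
split => //; apply/integrableP; split.
  by apply/measurable_EFinP; exact: measurable_funX.
apply: le_lt_trans (iF K cK KO).
rewrite [leRHS]integral_mkcond.
have -> : (fun x : T => ((enorm (F x)) ^+ 2)%:E) \_ K =
    ((fun x : T => ((enorm (F x)) ^+ 2)%:E) \_ K) \_ D.
  apply/funext => x; rewrite !patchE; case: ifPn => xK; last by case: ifP.
  by rewrite mem_set//; apply: KO; exact: set_mem.
rewrite -integral_mkcond.
have mE : measurable_fun D (fun x : T => (\1_K x : R) * enorm (F x) ^+ 2).
  apply: measurable_funM; first exact: measurable_indic.
  rewrite (_ : (fun _ => _) = (fun x : T => \sum_i (F x ord0 i) ^+ 2)).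
    by apply: measurable_sum => j; exact: measurable_funX.
  by apply/funext => x; rewrite enorm_sqr; apply: eq_bigr => j _; rewrite expr2.
have -> : (fun x : T => ((enorm (F x)) ^+ 2)%:E) \_ K =
    (fun x : T => ((\1_K x : R) * enorm (F x) ^+ 2)%:E).
  by apply/funext => x; rewrite patchE indicE; case: ifPn; rewrite ?mul1r ?mul0r.
have mFi : measurable_fun D
    (abse \o (EFin \o (fun x : T => ((\1_K x : R) *: F x) ord0 i ^+ 2))).
  by apply: measurableT_comp => //; apply/measurable_EFinP; exact: measurable_funX.
have mED : measurable_fun D (EFin \o (fun x : T => (\1_K x : R) * enorm (F x) ^+ 2)).
  exact/measurable_EFinP.
apply: (@ge0_le_integral _ T R mu D mD _ _ _ mFi mED) => [x _|x Dx]; first exact: abse_ge0.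
rewrite /= lee_fin ger0_norm ?sqr_ge0// mxE exprMn.
have -> : (\1_K x : R) ^+ 2 = \1_K x.
  by rewrite indicE; case: (_ \in _); rewrite ?expr1n ?expr0n.
by rewrite enorm_sqr ler_wpM2l ?dotv_coord// indicE ler0n.
Qed.

(** The way back from the weighted problem: [r] may blow up towards the boundary of [Omega]. *)
Lemma L2loc_bounded_mul (r : T -> R) (G : T -> 'rV[R]_n) :
  measurable_fun D r -> L2 G ->
  (forall K, compact K -> K `<=` Omega -> exists c, forall x, K x -> `|r x| <= c) ->
  L2loc Omega (fun x => r x *: G x).
Proof.
move=> mr LG rK; split.
  move=> i; rewrite (_ : (fun _ => _) = (fun x : T => r x * G x ord0 i)).
    exact: (measurable_funM mr (LG i).1).
  by apply/funext => x; rewrite mxE.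
move=> K cK KO; have [c rc] := rK K cK KO; have mK := compact_lebesgue_measurable cK.
have iG : mu.-integrable D (EFin \o (fun x => dotv (G x) (G x))).
  have := @ip_integrable _ T R mu D mD n (fun=> 1%:M) 1 _ _ G G LG LG.
  under eq_fun do rewrite mulmv1; apply; first by move=> i j; exact: measurable_cst.
  by move=> x i j _; rewrite mxE; case: (i == j); rewrite ?normr1 ?normr0.
have iK : mu.-integrable K (EFin \o (fun x => c ^+ 2 * dotv (G x) (G x))).
  apply: (@integrableZl _ _ _ mu K mK (c ^+ 2) (fun x => (dotv (G x) (G x))%:E)).
  exact: integrableS iG.
have mKF i : measurable_fun (K : set T) (fun x : T => r x * G x ord0 i).
  apply: (measurable_funS mD KO).
  exact: (measurable_funM mr (LG i).1).
have mE : measurable_fun (K : set T) (fun x : T => enorm (r x *: G x) ^+ 2).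
  rewrite (_ : (fun _ => _) = (fun x : T => \sum_i (r x * G x ord0 i) ^+ 2)).
    by apply: measurable_sum => i; exact: measurable_funX.
  by apply/funext => x; rewrite enorm_sqr; apply: eq_bigr => i _; rewrite mxE expr2.
move/integrableP : iK => [mGK]; apply: le_lt_trans.
have mEK : measurable_fun (K : set T) (EFin \o (fun x : T => enorm (r x *: G x) ^+ 2)).
  exact/measurable_EFinP.
have maGK := measurableT_comp (@abse_measurable R _) mGK.
apply: (@ge0_le_integral _ T R mu K mK _ _ _ mEK maGK) => [x _|x Kx].
  by rewrite /= lee_fin sqr_ge0.
rewrite /= lee_fin ger0_norm; last first.
  by apply: mulr_ge0; [exact: sqr_ge0|exact: dotv_ge0].
rewrite enorm_sqr dotvZl dotvZr mulrA -expr2 ler_wpM2r ?dotv_ge0//.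
have h := rc x Kx; have h0 := le_trans (normr_ge0 _) h.
by rewrite -real_normK ?num_real//; apply: lerXn2r; rewrite ?nnegrE.
Qed.

End test_L2.

(** The weight is the sum of [c j] times the indicator of [U j], with [c j = 2^-j / (1 + B j)]. From
    [c j * B j <= 2^-j] the integrals add up to at most 2; from [c j <= 2^-j] the weight is finite;
    on [U j] it is at least [c j]. *)
Lemma summable_weight d (T : measurableType d) (R : realType)
    (mu : {measure set T -> \bar R}) (D : set T) (U : nat -> set T) (B : nat -> R) :
  measurable D -> (forall j, measurable (U j)) -> (forall j, U j `<=` D) ->
  (forall j, 0 <= B j) ->
  exists w : T -> R, [/\ measurable_fun setT w, forall x, 0 <= w x,
    forall j, exists2 c, 0 < c & forall x, U j x -> c <= w x &
    forall f : T -> R, measurable_fun D f -> (forall x, 0 <= f x) ->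
      (forall j, \int[mu]_(x in U j) (f x)%:E <= (B j)%:E)%E ->
      (\int[mu]_(x in D) (w x * f x)%:E <= 2%:E)%E].
Proof.
move=> mD mU UD B0.
pose c j : R := 2^-1 ^+ j / (1 + B j).
have b0 j : 0 < 1 + B j by have := B0 j; lra.
have q0 j : 0 < 2^-1 ^+ j :> R by apply: exprn_gt0; lra.
have c0 j : 0 < c j by rewrite divr_gt0.
have cB j : c j * B j <= 2^-1 ^+ j.
  rewrite /c mulrAC ler_pdivrMr//; have := q0 j; have := B0 j; nra.
have c2 j : c j <= 2^-1 ^+ j.
  rewrite /c ler_pdivrMr//; have := q0 j; have := B0 j; nra.
have i0 j x : 0 <= \1_(U j) x :> R by rewrite indicE ler0n.
have i1 j x : \1_(U j) x <= 1 :> R by rewrite indicE; case: (_ \in _).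
pose h j x : \bar R := (c j * \1_(U j) x)%:E.
have h0 j x : (0 <= h j x)%E by rewrite lee_fin; apply: mulr_ge0; [exact: ltW|exact: i0].
pose W x := (\sum_(j <oo) h j x)%E.
have sum2 m : \sum_(0 <= j < m) 2^-1 ^+ j <= 2 :> R.
  by apply: sum_geometric_le2; lra.
have W2 x : (W x <= 2%:E)%E.
  apply: nneseries_le => [//|m]; rewrite sumEFin lee_fin; apply: le_trans (sum2 m).
  apply: ler_sum => j _; apply: le_trans (c2 j).
  by apply: ler_piMr; [exact: ltW|exact: i1].
have W0 x : (0 <= W x)%E by apply: nneseries_ge0.
have Wfin x : (W x \is a fin_num)%E.
  by rewrite ge0_fin_numE// (le_lt_trans (W2 x))// ltry.
have mh j (E : set T) : measurable_fun E (h j).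
  apply: (@measurable_funS _ _ _ _ setT) => //.
  by apply/measurable_EFinP; apply: measurable_funM => //; exact: measurable_indic.
have hW j x : (h j x <= W x)%E.
  by rewrite /W (@nneseriesD1 _ _ j)//; apply: leeDl; apply: nneseries_ge0.
exists (fun x => fine (W x)); split.
- apply: measurableT_comp => //.
  by apply: (@ge0_emeasurable_sum _ _ _ setT h xpredT) => // j _; exact: mh.
- by move=> x; exact: fine_ge0.
- move=> j; exists (c j) => // x Ux; rewrite -lee_fin fineK//.
  by have := hW j x; rewrite /h indicE mem_set// mulr1.
move=> f mf f0 fB.
have E x : (fine (W x) * f x)%:E = (\sum_(j <oo) (c j * (\1_(U j) x * f x))%:E)%E.
  rewrite EFinM fineK// muleC -nneseriesZl//.
  by apply: eq_eseriesr => j _; rewrite -EFinM; congr EFin; ring.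
under eq_integral => x _ do rewrite E.
have t0 j x : 0 <= c j * (\1_(U j) x * f x).
  by apply: mulr_ge0; [exact: ltW|exact: mulr_ge0].
have mt j : measurable_fun D (fun x => \1_(U j) x * f x).
  by apply: measurable_funM => //; exact: measurable_indic.
have mt2 j : measurable_fun D (fun x => (c j * (\1_(U j) x * f x))%:E).
  by apply/measurable_EFinP; exact: measurable_funM.
have t2 j x : D x -> (0 <= (c j * (\1_(U j) x * f x))%:E)%E by rewrite lee_fin.
rewrite (integral_nneseries mu mD mt2 t2).
apply: nneseries_le => [j|m].
  by apply: integral_ge0 => x _; rewrite lee_fin.
have tB j : (\int[mu]_(x in D) (c j * (\1_(U j) x * f x))%:E <= (2^-1 ^+ j)%:E)%E.
  under eq_integral => x _ do rewrite EFinM.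
  have p1 x : D x -> (0 <= (\1_(U j) x * f x)%:E)%E by rewrite lee_fin mulr_ge0.
  have /measurable_EFinP p2 := mt j.
  rewrite (ge0_integralZl_EFin mu mD p1 p2 (ltW (c0 j))).
  have -> : (\int[mu]_(x in D) (\1_(U j) x * f x)%:E = \int[mu]_(x in U j) (f x)%:E)%E.
    rewrite [RHS]integral_mkcond [LHS]integral_mkcond; apply: eq_integral => x _.
    rewrite !patchE indicE; case: (boolP (x \in U j)) => xU.
      by rewrite mul1r mem_set//; apply: (UD j); exact: set_mem.
    by rewrite mul0r; case: ifP.
  apply: (@le_trans _ _ ((c j)%:E * (B j)%:E)%E); last by rewrite -EFinM lee_fin.
  by apply: lee_wpmul2l => //; rewrite lee_fin ltW.
by apply: le_trans (lee_sum _ (fun j _ => tB j)) _; rewrite sumEFin lee_fin.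
Qed.

(** * The constraints *)

Lemma scaled_le1 (R : realFieldType) (k p e : R) :
  k * (4 * (1 * p + e)) = 1 -> 0 <= k * e -> 4 * k * p <= 1.
Proof. by lra. Qed.

Lemma mul_neg2_sqr (R : comPzRingType) (p k a : R) :
  p * (-2 * (k * (-2 * (k * a)))) = 4 * k * p * (k * a).
Proof. by ring. Qed.

(** For [constraint_approx]: [s] is [sigma phi], [t] is [sigma] at the squared cutoff, [c] the
    energy of the cutoff, [a] the form at [K] and the gradient of [phi], [b] the quadratic term at
    [G = -2 K]. *)
Lemma energy_bound (R : realFieldType) (s t e d a b c : R) :
  e * t + s <= a + e * c -> e * (c - t) <= d -> b <= a -> s + (-2 * a + b) <= d.
Proof. by lra. Qed.

(** With [E = eta G], the letters [a], [b], [c] are the form at [E, E], at [E, grad eta] and at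
    [grad eta, grad eta]. The second hypothesis says [- 2 b <= a / 2 + 2 c], and half of [a] is
    absorbed. *)
Lemma young_absorb (R : realFieldType) (s t a b c N : R) :
  s + (2 * b + a) <= 1 -> 0 <= 2 * (2 * c + b) + (2 * b + a) -> N <= a ->
  - s <= t -> N <= 2 * (1 + t + 2 * c).
Proof. by lra. Qed.

Lemma coercivity_bound_ge0 (R : realFieldType) (k t c : R) :
  0 <= k -> 0 <= t -> 0 <= c -> 0 <= 2 / k * (1 + t + 2 * c).
Proof. by move=> k0 t0 c0; rewrite mulr_ge0 ?divr_ge0//; lra. Qed.

Section duality.
Variables (R : realType) (n : nat) (Omega : set 'rV[R]_n).
Hypothesis oOmega : open Omega.
Local Notation T := (lebesgueTypeRn R n).
Local Notation mu := (@lebesgue_rV R n).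
Local Notation D := (Omega : set T).
Local Notation L2 := (@L2 _ T R mu D n).
Variables (sigma : ('rV[R]_n -> R) -> R).
Hypothesis sigma_lin : forall (a : R) phi psi,
  test_function Omega phi -> test_function Omega psi ->
  sigma (fun x => a * phi x + psi x) = a * sigma phi + sigma psi.
Variables (A : T -> 'M[R]_n) (m M : R).
Hypothesis mA : forall i j, measurable_fun D (fun x => A x i j).
Hypothesis bA : forall x i j, D x -> `|A x i j| <= M.
Hypothesis sA : forall x, D x -> (A x)^T = A x.
Hypothesis m0 : 0 < m.
Hypothesis lA : forall x u, D x -> m * dotv u u <= dotv (mulmv (A x) u) u.
Local Notation ipA := (ip mu D A).
Local Notation grad f := (gradient f : T -> 'rV[R]_n).

Let mD : measurable D. Proof. exact: measurable_Omega. Qed.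

Let pA x u : D x -> 0 <= dotv (mulmv (A x) u) u.
Proof.
move=> Dx; apply: le_trans (lA u Dx); apply: mulr_ge0; first exact: ltW.
exact: dotv_ge0.
Qed.

Definition admissible (phi : 'rV[R]_n -> R) :=
  test_function Omega phi /\ forall x, 0 <= phi x.

Definition constraint (phi : 'rV[R]_n -> R) (G : T -> 'rV[R]_n) : R :=
  qf mu D A (sigma phi) phi (grad phi) G.

Lemma sigma_comb s t phi psi : test_function Omega phi -> test_function Omega psi ->
  sigma (fun x => s * phi x + t * psi x) = s * sigma phi + t * sigma psi.
Proof.
move=> tphi tpsi; have t0 := test_function0 Omega.
have s0 : sigma (fun=> 0) = 0.
  have := sigma_lin 1 t0 t0.
  rewrite (_ : (fun _ => _) = fun=> 0); last by apply/funext => x; rewrite mulr0 addr0.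
  by lra.
have -> : (fun x => s * phi x + t * psi x) = (fun x => s * phi x + (t * psi x + 0)).
  by apply/funext => x; rewrite addr0.
rewrite sigma_lin//; last exact: (test_functionZD t tpsi t0).
by rewrite (sigma_lin t tpsi t0) s0 addr0.
Qed.

Lemma test_comb s t phi psi : test_function Omega phi -> test_function Omega psi ->
  test_function Omega (fun x => s * phi x + t * psi x).
Proof.
move=> tphi tpsi; apply: test_functionZD => //.
have [spsi _ _] := tpsi; apply: (test_functionW tpsi).
  by apply: smoothM => //; exact: smooth_cst.
by move=> x ->; rewrite mulr0.
Qed.

Lemma gradient_comb s t phi psi x : smooth phi -> smooth psi ->
  gradient (fun y : 'rV[R]_n => s * phi y + t * psi y) x =
  s *: gradient phi x + t *: gradient psi x.
Proof.
move=> sphi spsi; have sc := @smooth_cst R n t; rewrite gradientZD//; last exact: smoothM.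
by rewrite gradientM// gradient_cst scaler0 addr0.
Qed.

Lemma constraint_comb s t phi psi G : admissible phi -> admissible psi -> L2 G ->
  constraint (fun x => s * phi x + t * psi x) G =
  s * constraint phi G + t * constraint psi G.
Proof.
move=> [tphi phi0] [tpsi psi0] LG.
have Lg1 := test_gradient_L2 oOmega tphi; have Lg2 := test_gradient_L2 oOmega tpsi.
have LL f : admissible f -> L2 (fun x => f x *: G x).
  move=> [tf f0]; have [C _ fC] := test_bounded tf.
  apply: (@L2_mul _ _ _ _ _ mD _ _ _ C) => //.
  by apply: test_measurable; case: tf.
have L1 := LL _ (conj tphi phi0); have L2' := LL _ (conj tpsi psi0).
rewrite /constraint /qf sigma_comb//.
have -> : grad (fun x : 'rV[R]_n => s * phi x + t * psi x) = s *: grad phi + t *: grad psi.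
  by apply/funext => x; rewrite gradient_comb//; [case: tphi|case: tpsi].
have -> : (fun x : T => (s * phi x + t * psi x) *: G x) =
    s *: (fun x : T => phi x *: G x) + t *: (fun x : T => psi x *: G x).
  by apply/funext => x; rewrite !fctE scalerDl !scalerA.
rewrite (ipZDr mD mA bA s Lg1 (L2Z mD t Lg2) LG) (ipZr mD mA bA t Lg2 LG).
rewrite (ipZDl mD mA bA s L1 (L2Z mD t L2') LG) (ipZl mD mA bA t L2' LG).
move: (sigma phi) (sigma psi) (ipA G (grad phi)) (ipA G (grad psi)).
by move: (ipA _ G) (ipA _ G) => a1 a2 a3 a4 a5 a6; ring.
Qed.

Lemma constraint_convex phi : admissible phi ->
  convex_on [set G | L2 G] (constraint phi).
Proof.
by move=> [tphi phi0]; apply: (qf_convex mD mA bA sA pA); exact: test_qf_data.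
Qed.

Hypothesis form : forall h, test_function Omega h ->
  sigma (fun x => h x ^+ 2) <= ipA (grad h) (grad h).

(* The pointwise minimizer of the constraint functional is [- grad phi / (2 phi)]
   and its minimum is [sigma phi] minus the energy of [sqrt phi]; adding [e] under
   the root makes [eta * sqrt (phi + e)] a test function, where the cutoff [eta] is
   [1] near the support of [phi]. *)
Lemma constraint_approx phi dl : admissible phi -> 0 < dl ->
  exists2 G, L2 G & constraint phi G <= dl.
Proof.
move=> [tphi phi0] dl0; have [sphi cphi phiO] := tphi.
have [eta [U [teta eta1 oU _ Ucov]]] := smooth_exhaustion oOmega.
have [j phiU] := Ucov _ cphi phiO.
set et := eta j; have [te et0] := teta j; rewrite -/et in te et0.
have [se _ _] := te.
have Lphi := test_gradient_L2 oOmega tphi; have Let := test_gradient_L2 oOmega te.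
pose E1 := ipA (grad et) (grad et) - sigma (fun x => et x ^+ 2).
(* The regularization costs [e * E1], which this choice keeps below [dl]. *)
pose e := dl / (1 + `|E1|).
have E10 : 0 < 1 + `|E1| by have := normr_ge0 E1; lra.
have e0 : 0 < e by exact: divr_gt0.
have eE : e * E1 <= dl.
  rewrite /e mulrAC ler_pdivrMr// ler_wpM2l ?(ltW dl0)//.
  by have := ler_norm E1; lra.
pose g x := 1 * phi x + e.
have sg : smooth g.
  apply: smoothD; last exact: smooth_cst.
  by apply: smoothM => //; exact: smooth_cst.
have g0 x : 0 < g x by rewrite /g; have := phi0 x; lra.
have srt : smooth (fun x => Num.sqrt (g x)) by exact: smooth_sqrt.
have gradg x : gradient g x = gradient phi x.
  by rewrite gradientZD ?scale1r ?gradient_cst ?addr0//; exact: smooth_cst.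
(* Hence no mixed product of the two gradients survives in the energy of [h]. *)
have alt x : (et x = 1 /\ gradient et x = 0) \/ (phi x = 0 /\ gradient phi x = 0).
  have [/phiU Ux|nx] := pselect (fsupp phi x); [left|right].
    split; first exact: eta1.
    rewrite -(gradient_cst 1 x); apply: near_eq_gradient.
    have [+ _] := oU j; rewrite openE => /(_ _ Ux); apply: filterS => y.
    exact: eta1.
  by split; [exact: fsupp_eq0|exact: gradient_eq0].
pose h x := et x * Num.sqrt (g x).
have th : test_function Omega h by exact: test_functionM.
(* The square is exactly [phi] plus a multiple of a fixed test function, so linearity gives [sigma]
   at it. *)
have h2 : (fun x => h x ^+ 2) = (fun x => e * et x ^+ 2 + phi x).
  apply/funext => x; rewrite /h exprMn sqr_sqrtr ?(ltW (g0 x))// /g.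
  by case: (alt x) => -[-> _]; ring.
(* The factor in [|grad sqrt g|^2 = |grad g|^2 / (4 g)]. *)
pose k x := (4 * g x)^-1.
have k0 x : 0 < k x by rewrite invr_gt0 mulr_gt0.
have mk : measurable_fun D (k : T -> R).
  apply: test_measurable; apply: smoothV; last by move=> x; rewrite mulf_neq0// gt_eqF.
  by apply: smoothM => //; exact: smooth_cst.
pose K : T -> 'rV[R]_n := fun x => k x *: gradient phi x.
have LK : L2 K.
  apply: (@L2_mul _ _ _ _ _ mD _ _ _ (4 * e)^-1) => // x _.
  rewrite gtr0_norm// lef_pV2 ?posrE ?mulr_gt0// ler_pM2l//.
  by rewrite /g; have := phi0 x; lra.
have energy : ipA (grad h) (grad h) = ipA K (grad phi) + e * ipA (grad et) (grad et).
  rewrite -(ipZl mD mA bA e Let Let).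
  have i1 := ip_integrable mD mA bA LK Lphi.
  have i2 := ip_integrable mD mA bA (L2Z mD e Let) Let.
  rewrite [in RHS]/ip -RintegralD//; apply: eq_Rintegral => x _.
  rewrite gradientM// gradient_sqrt// gradg.
  have EK : K x = k x *: gradient phi x by [].
  have Ee : (e *: grad et) x = e *: gradient et x by [].
  rewrite EK Ee; case: (alt x) => -[a1 a2]; rewrite a2.
    rewrite a1 !scaler0 addr0 scale1r !mulmvZ !dotvZl !dotvZr mulmv0 dotv0l addr0.
    rewrite mulrA; congr (_ * _); rewrite -invfM /k; congr (_^-1).
    transitivity (4 * Num.sqrt (g x) ^+ 2); first by ring.
    by rewrite sqr_sqrtr// ltW.
  rewrite !scaler0 add0r dotv0r add0r !mulmvZ !dotvZl dotvZr mulrA -expr2.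
  by rewrite sqr_sqrtr ?ltW// /g a1 mulr0 add0r.
(* This is [- grad phi / (2 g)], the pointwise minimizer with [g = phi + e] in the denominator. *)
pose G := (-2) *: K; have LG : L2 G by exact: L2Z.
exists G => //.
have [C _ phiC] := test_bounded tphi.
have LpG : L2 (fun x => phi x *: G x).
  by apply: (@L2_mul _ _ _ _ _ mD _ _ _ C) => //; exact: test_measurable.
have le2 : ipA (fun x => phi x *: G x) G <= ipA K (grad phi).
  apply: (le_ip mD mA bA LpG LG LK Lphi) => x Dx.
  have -> : G x = (-2) *: (k x *: gradient phi x) by [].
  have -> : K x = k x *: gradient phi x by [].
  rewrite !mulmvZ !dotvZl !dotvZr.
  set a := dotv _ _; have a0 : 0 <= a by exact: pA.
  have kg : k x * (4 * g x) = 1 by rewrite /k mulVf// gt_eqF// mulr_gt0.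
  (* The left side is [phi x / g x]. *)
  have h4 : 4 * k x * phi x <= 1.
    have ke : 0 <= k x * e by rewrite mulr_ge0 ?(ltW (k0 x)) ?(ltW e0).
    exact: scaled_le1 kg ke.
  have -> : phi x * (-2 * (k x * (-2 * (k x * a)))) = (4 * k x * phi x) * (k x * a).
    exact: mul_neg2_sqr.
  by rewrite ler_piMl// mulr_ge0// ltW.
rewrite /constraint /qf (ipZl mD mA bA (-2) LK Lphi).
have := form th; rewrite h2 sigma_lin//; last exact: test_function_sqr.
by rewrite energy => /energy_bound; apply.
Qed.

Lemma constraint_feasible (Fs : seq ('rV[R]_n -> R)) dl :
  (forall f, f \in Fs -> admissible f) -> 0 < dl ->
  exists2 G, L2 G & {in Fs, forall f, constraint f G <= dl}.
Proof.
apply: (@minimax_seq R (T -> 'rV[R]_n) ('rV[R]_n -> R) admissible constraint [set G | L2 G]).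
- by exists (fun=> 0); split => //; exact: test_function0.
- move=> f g s t [tf f0] [tg g0] s0 t0; exists (fun x => s * f x + t * g x).
    split; first exact: test_comb.
    by move=> x; rewrite addr_ge0// mulr_ge0.
  by move=> G LG; exact: constraint_comb.
- by move=> F G s LF LG _; exact: (L2ZD mD s LF (L2Z mD (1 - s) LG)).
- by move=> f; exact: constraint_convex.
- by move=> f d; exact: constraint_approx.
Qed.

(* Constraints at squares bound [G]: by Young's inequality the linear term
   [2 a(eta G, grad eta)] is absorbed by [a(eta G, eta G) / 2]. *)
Lemma constraint_coercive eta G : test_function Omega eta -> L2 G ->
  constraint (fun x => eta x ^+ 2) G <= 1 ->
  L2sqr mu D (fun x => eta x *: G x) <= (2 / m) * (1 + `|sigma (fun x => eta x ^+ 2)| +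
    2 * ipA (grad eta) (grad eta)).
Proof.
move=> te LG; have [se _ _] := te; have [C _ eC] := test_bounded te.
have Le := test_gradient_L2 oOmega te.
pose E : T -> 'rV[R]_n := fun x => eta x *: G x.
have LE : L2 E.
  by apply: (@L2_mul _ _ _ _ _ mD _ _ _ C) => //; exact: test_measurable.
rewrite /constraint /qf.
have -> : ipA (fun x => eta x ^+ 2 *: G x) G = ipA E E.
  by apply: eq_ip => x _; rewrite /E !mulmvZ !dotvZl dotvZr mulrA expr2.
have -> : ipA G (grad (fun x : 'rV[R]_n => eta x ^+ 2)) = ipA (2 *: E) (grad eta).
  apply: eq_ip => x _; have -> : (2 *: E) x = 2 *: (eta x *: G x) by [].
  rewrite (_ : (fun x => eta x ^+ 2) = (fun x => eta x * eta x))//.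
  by rewrite gradientM// !mulmvZ !dotvZl dotvDr !dotvZr; ring.
rewrite (ipZl mD mA bA 2 LE Le).
(* Nonnegativity of the form at this field is the Young inequality that [young_absorb] consumes. *)
have LB : L2 (2 *: grad eta + E) by exact: L2ZD.
have : 0 <= ipA (2 *: grad eta + E) (2 *: grad eta + E).
  by apply: Rintegral_ge0 => x; exact: pA.
rewrite (ipZDl mD mA bA 2 Le LE LB) (ipZDr mD mA bA 2 Le LE Le).
rewrite (ipZDr mD mA bA 2 Le LE LE) (@ipC _ _ _ mu D n A (grad eta) E sA).
move=> Q0; have : m * L2sqr mu D E <= ipA E E.
  have := @ip_integrable _ T R mu D mD n (fun=> 1%:M) 1 _ _ E E LE LE.
  move=> iE; have {}iE : mu.-integrable D (EFin \o (fun x => dotv (E x) (E x))).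
    under eq_fun do rewrite -[E _ in X in dotv X _]mulmv1; apply: iE.
      by move=> i j; exact: measurable_cst.
    by move=> x i j _; rewrite mxE; case: (i == j); rewrite ?normr1 ?normr0.
  rewrite L2sqrE -RintegralZl//; apply: le_Rintegral => //.
  - exact: (@integrableZl _ _ _ mu D mD m _ iE).
  - exact: (ip_integrable mD mA bA LE LE).
  - by move=> x; exact: lA.
have -> : 2 / m * (1 + `|sigma (fun x => eta x ^+ 2)| + 2 * ipA (grad eta) (grad eta)) =
  (2 * (1 + `|sigma (fun x => eta x ^+ 2)| + 2 * ipA (grad eta) (grad eta))) / m.
  by rewrite mulrAC.
rewrite ler_pdivlMr// -/E (mulrC _ m).
move: Q0; have := ler_norm (- sigma (fun x => eta x ^+ 2)); rewrite normrN.
by move=> h4 h2 h3 h1; exact: young_absorb h1 h2 h3 h4.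
Qed.

Lemma exhaustion_seq (U : nat -> set 'rV[R]_n) (Fs : seq ('rV[R]_n -> R)) :
  (forall j k, (j <= k)%N -> U j `<=` U k) ->
  (forall K, compact K -> K `<=` Omega -> exists j, K `<=` U j) ->
  {in Fs, forall f, admissible f} -> exists J, {in Fs, forall f, fsupp f `<=` U J}.
Proof.
move=> UU Ucov; elim: Fs => [|f Fs IH] aF; first by exists 0%N.
have [|J JP] := IH; first by move=> g gF; apply: aF; rewrite inE gF orbT.
have [[_ cf fO] _] : admissible f by apply: aF; rewrite inE eqxx.
have [k fk] := Ucov _ cf fO; exists (maxn J k) => g; rewrite inE => /predU1P[->|/JP gJ].
  by apply: subset_trans fk _; apply: UU; exact: leq_maxr.
by apply: subset_trans gJ _; apply: UU; exact: leq_maxl.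
Qed.

(** * From finitely many constraints to all of them *)

Section weight.
Variables (eta : nat -> 'rV[R]_n -> R) (U : nat -> set 'rV[R]_n).
Hypothesis teta : forall j, test_function Omega (eta j) /\ (forall x, 0 <= eta j x).
Hypothesis eta1 : forall j x, U j x -> eta j x = 1.
Hypothesis oU : forall j, open (U j) /\ U j `<=` Omega.
Hypothesis UU : forall j k, (j <= k)%N -> U j `<=` U k.
Hypothesis Ucov : forall K, compact K -> K `<=` Omega -> exists j, K `<=` U j.

Let b j := (2 / m) * (1 + `|sigma (fun x => eta j x ^+ 2)| +
    2 * ipA (grad (eta j)) (grad (eta j))).
(** Summing makes the bounds monotone: a field truncated at stage [J] is estimated with the cutoff
    of index [minn j J], but its bound on [U j] must not depend on [J]. *)
Let B j := \sum_(i < j.+1) b i.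

Let b0 j : 0 <= b j.
Proof.
have p : 0 <= ipA (grad (eta j)) (grad (eta j)).
  by apply: Rintegral_ge0 => x; exact: pA.
exact: coercivity_bound_ge0 (ltW m0) (normr_ge0 _) p.
Qed.

Let B0 j : 0 <= B j. Proof. exact: sumr_ge0. Qed.

Let bB i j : (i <= j)%N -> b i <= B j.
Proof.
move=> ij; rewrite /B (bigD1 (Ordinal (ij : (i < j.+1)%N)))//= lerDl.
exact: sumr_ge0.
Qed.

Variable w : T -> R.
Hypothesis mw : measurable_fun setT w.
Hypothesis w0 : forall x, 0 <= w x.
Hypothesis wU : forall j, exists2 c, 0 < c & forall x, U j x -> c <= w x.
Hypothesis wint : forall f : T -> R, measurable_fun D f -> (forall x, 0 <= f x) ->
  (forall j, \int[mu]_(x in U j) (f x)%:E <= (B j)%:E)%E ->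
  (\int[mu]_(x in D) (w x * f x)%:E <= 2%:E)%E.

(* [G] in L2(Omega) stands for the locally square integrable field [r G]. *)
Let q x : R := Num.sqrt (w x).
Let r x : R := (q x)^-1.

Let mq : measurable_fun D q.
Proof.
rewrite (_ : q = (fun x => w x `^ 2^-1)).
  exact: measurable_funTS (measurableT_comp (measurable_powR 2^-1) mw).
by apply/funext => x; rewrite powR12_sqrt.
Qed.

Let mr : measurable_fun D r.
Proof.
rewrite (_ : r = (fun x => w x `^ (- 2^-1))).
  exact: measurable_funTS (measurableT_comp (measurable_powR (- 2^-1)) mw).
by apply/funext => x; rewrite powRN powR12_sqrt.
Qed.

Let w_gt0 x : D x -> 0 < w x.
Proof.
move=> Dx; have [|j xU] := @Ucov [set x] (@compact_set1 _ x); first by move=> y ->.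
by have [c c0 cw] := wU j; apply: lt_le_trans c0 (cw _ _); exact: xU.
Qed.

Let q_neq0 x : D x -> q x != 0.
Proof. by move=> /w_gt0 wx; rewrite gt_eqF// sqrtr_gt0. Qed.

Let r_ge0 x : 0 <= r x. Proof. by rewrite invr_ge0 sqrtr_ge0. Qed.

Let r_bounded j : exists2 c, 0 <= c & forall x, U j x -> r x <= c.
Proof.
have [c c0 cw] := wU j; exists (Num.sqrt c)^-1 => [|x Ux].
  by rewrite invr_ge0 sqrtr_ge0.
rewrite /r /q lef_pV2 ?posrE ?sqrtr_gt0 ?ler_wsqrtr ?cw//.
exact: lt_le_trans c0 (cw x Ux).
Qed.

(** The constraint of [f] at the field [r G], as a quadratic functional of [G]. *)
Let wconstraint f G : R :=
  qf mu D A (sigma f) (fun x => r x ^+ 2 * f x) (fun x => r x *: gradient f x) G.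

(** The support of [f] lies in some [U j], where [r] is bounded. *)
Let wqf_data f : admissible f ->
  qf_data mu D (fun x : T => r x ^+ 2 * f x) (fun x : T => r x *: gradient f x).
Proof.
move=> [tf f0]; have [sf cf fO] := tf; have [j fU] := Ucov cf fO.
have [c c0 rc] := r_bounded j; have [C C0 fC] := test_bounded tf.
have alt x : r x <= c \/ (f x = 0 /\ gradient f x = 0).
  have [/fU Ux|nx] := pselect (fsupp f x); [left; exact: rc|right].
  by split; [exact: fsupp_eq0|exact: gradient_eq0].
have Lf := test_gradient_L2 oOmega tf.
split.
- move=> i; apply: (sL2_bounded mD (g := fun x => gradient f x ord0 i) (C := c)).
  + rewrite (_ : (fun _ => _) = (fun x : T => r x * gradient f x ord0 i)).
      exact: (measurable_funM mr (Lf i).1).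
    by apply/funext => x; rewrite mxE.
  + exact: Lf.
  + move=> x _; rewrite mxE normrM (ger0_norm (r_ge0 x)).
    case: (alt x) => [rx|[_ ->]]; first exact: ler_wpM2r.
    by rewrite mxE normr0 !mulr0.
- apply: measurable_funM; first exact: measurable_funX.
  exact: test_measurable.
- by move=> x _; rewrite mulr_ge0 ?sqr_ge0.
- exists (c ^+ 2 * C) => x _; case: (alt x) => [rx|[-> _]]; last first.
    by rewrite mulr0 mulr_ge0 ?sqr_ge0.
  apply: ler_pM => //; first exact: sqr_ge0.
    by apply: lerXn2r; rewrite ?nnegrE.
  exact: le_trans (ler_norm _) (fC x).
Qed.

(** The constraints in [Fs] are solved together with those at the squares of the cutoffs up to [J],
    which supply the bound. Outside [U J], where nothing in [Fs] is supported, the field is set to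
    0; this makes the bound uniform in [J]. *)
Let wfeasible (Fs : seq ('rV[R]_n -> R)) (dl : R) :
  {in Fs, forall f, admissible f} -> 0 < dl ->
  exists2 G, L2 G & L2sqr mu D G <= 2 /\ {in Fs, forall f, wconstraint f G <= dl}.
Proof.
move=> aF dl0; have [J FJ] := exhaustion_seq UU Ucov aF.
pose L := Fs ++ [seq (fun x => eta i x ^+ 2) | i <- iota 0 J.+1].
(* The bound 1 is what [constraint_coercive] requires at the squared cutoffs. *)
have d0 : 0 < Num.min dl 1 by rewrite lt_min dl0 ltr01.
have [f|G0 LG0 qG0] := @constraint_feasible L _ _ d0.
  rewrite mem_cat => /orP[/aF//|/mapP[i _ ->]]; split.
    by apply: test_function_sqr; have [] := teta i.
  by move=> x; exact: sqr_ge0.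
have mU j : measurable (U j : set T).
  by have [oUj _] := oU j; exact: open_lebesgue_measurable.
pose G1 : T -> 'rV[R]_n := fun x => (\1_(U J) x : R) *: G0 x.
have LG1 : L2 G1.
  have mi : measurable_fun D (\1_(U J) : T -> R) by exact: measurable_indic.
  have i1 x : D x -> `|\1_(U J) x : R| <= 1.
    by move=> _; rewrite indicE; case: (_ \in _); rewrite ?normr1 ?normr0.
  exact: (L2_mul mD mi i1 LG0).
pose f x : R := dotv (G1 x) (G1 x).
have f0 x : 0 <= f x by exact: dotv_ge0.
have mdot (F : T -> 'rV[R]_n) : L2 F -> measurable_fun D (fun x => dotv (F x) (F x)).
  by move=> LF; apply: measurable_sum => i; apply: measurable_funM; have [] := LF i.
have coer i : (i <= J)%N -> L2sqr mu D (fun x => eta i x *: G0 x) <= b i.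
  move=> iJ; apply: constraint_coercive => //; first by have [] := teta i.
  apply: (@le_trans _ _ (Num.min dl 1)); last by rewrite ge_min lexx orbT.
  apply: qG0; rewrite mem_cat; apply/orP; right; apply/mapP; exists i => //.
  by rewrite mem_iota.
have fB j : (\int[mu]_(x in U j) (f x)%:E <= (B j)%:E)%E.
  (* On [U j] the truncated field lives in the intersection with [U J], which is [U i], and there
     [eta i] is 1. *)
  pose i := minn j J; pose E : T -> 'rV[R]_n := fun x => eta i x *: G0 x.
  have [ti _] := teta i; have [C _ eC] := test_bounded ti.
  have LE : L2 E.
    have [si _ _] := ti.
    apply: (@L2_mul _ T R mu D mD n (eta i) G0 C _ _ LG0).
      exact: test_measurable.
    by move=> x _; exact: eC.
  have iE : mu.-integrable D (EFin \o (fun x => dotv (E x) (E x))).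
    rewrite (_ : _ \o _ = (fun x => \sum_i (E x ord0 i ^+ 2)%:E)%E).
      by apply: integrable_sum => // k _; have [] := LE k.
    by apply/funext => x /=; rewrite sumEFin.
  apply: (@le_trans _ _ (\int[mu]_(x in D) (dotv (E x) (E x))%:E)%E).
    apply: (@le_trans _ _ (\int[mu]_(x in U j) (dotv (E x) (E x))%:E)%E).
      have mfU : measurable_fun (U j : set T) (EFin \o f).
        by apply/measurable_EFinP; apply: (measurable_funS mD (oU j).2); exact: mdot.
      have mEU : measurable_fun (U j : set T) (EFin \o (fun x => dotv (E x) (E x))).
        by apply/measurable_EFinP; apply: (measurable_funS mD (oU j).2); exact: mdot.
      apply: (@ge0_le_integral _ T R mu (U j) (mU j) (EFin \o f)
        (EFin \o (fun x => dotv (E x) (E x))) _ mfU mEU) => [x _|x Uj].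
        by rewrite /= lee_fin f0.
      rewrite /= lee_fin /f /G1 /E indicE.
      have [UJ|nUJ] := pselect (U J x); last first.
        by rewrite memNset// scale0r dotv0l dotv_ge0.
      rewrite mem_set// (eta1 (j := i)) ?scale1r//.
      by rewrite /i /minn; case: ifP.
    have mED : measurable_fun D (EFin \o (fun x => dotv (E x) (E x))).
      by apply/measurable_EFinP; exact: mdot.
    apply: (@ge0_subset_integral _ T R mu (U j) D (mU j) mD _ mED) => [x _|].
      by rewrite /= lee_fin dotv_ge0.
    exact: (oU j).2.
  rewrite -(fineK (integrable_fin_num mD iE)) lee_fin.
  rewrite -[leLHS]/(\int[mu]_(x in D) dotv (E x) (E x)) -L2sqrE.
  apply: le_trans (coer i (geq_minr j J)) _; apply: bB; exact: geq_minl.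
have w2 := wint (mdot _ LG1) f0 fB.
(* Then [r G] is [G1] on [Omega], and the weighted integral of [G1] is the plain squared norm of
   [G]. *)
pose G : T -> 'rV[R]_n := fun x => q x *: G1 x.
have dG x : dotv (G x) (G x) = w x * f x.
  by rewrite dotvZl dotvZr mulrA -expr2 sqr_sqrtr.
have iwf : mu.-integrable D (EFin \o (fun x => w x * f x)).
  apply/integrableP; split.
    apply/measurable_EFinP; apply: measurable_funM; last exact: mdot.
    exact: measurable_funTS.
  rewrite (eq_integral (fun x => (w x * f x)%:E)); first by rewrite (le_lt_trans w2)// ltry.
  by move=> x _; rewrite /= ger0_norm// mulr_ge0.
have LG : L2 G.
  move=> i; have mGi : measurable_fun D (fun x => G x ord0 i).
    rewrite (_ : (fun _ => _) = (fun x => q x * G1 x ord0 i)).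
      exact: (measurable_funM mq (LG1 i).1).
    by apply/funext => x; rewrite mxE.
  split => //; apply: (le_integrable mD _ _ iwf).
    by apply/measurable_EFinP; exact: measurable_funX.
  move=> x _ /=; rewrite lee_fin ger0_norm ?sqr_ge0// -dG ger0_norm ?dotv_ge0//.
  exact: dotv_coord.
exists G => //; split.
  rewrite L2sqrE; under eq_Rintegral do rewrite dG.
  by rewrite -lee_fin fineK//; exact: (integrable_fin_num mD iwf).
move=> g gF; have [tg g0] := aF g gF.
have -> : wconstraint g G = constraint g G0.
  have alt x : D x -> \1_(U J) x = 1 :> R \/ (g x = 0 /\ gradient g x = 0).
    move=> _; have [gx|nx] := pselect (fsupp g x); [left|right].
      by rewrite indicE mem_set//; exact: (FJ g gF).
    by split; [exact: fsupp_eq0|exact: gradient_eq0].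
  rewrite /wconstraint /constraint /qf; congr (_ + (_ + _)); apply: eq_ip => x Dx.
    rewrite /G /G1 !mulmvZ !dotvZl dotvZr.
    case: (alt x Dx) => [->|[_ ->]]; last by rewrite dotv0r !mulr0.
    by rewrite mul1r mulrA /r mulfV ?mul1r// q_neq0.
  rewrite /G /G1 !mulmvZ !dotvZl !dotvZr.
  case: (alt x Dx) => [->|[-> _]]; last by rewrite !(mulr0, mul0r).
  have qr : q x * r x = 1 by rewrite /r mulfV// q_neq0.
  move: (dotv _ _) (q x) (r x) (g x) qr => a1 a2 a3 a4 qr.
  transitivity ((a2 * a3) ^+ 2 * (a4 * a1)); first by ring.
  by rewrite qr expr1n mul1r.
apply: le_trans (qG0 g _) _; first by rewrite mem_cat gF.
by rewrite ge_min lexx.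
Qed.

(** By [wfeasible] every finite subfamily is solvable up to any tolerance with [L2sqr] at most 2, so
    [convex_fip] yields a common [G]; the field is [r G]. *)
Lemma weighted_solution : exists2 G : T -> 'rV[R]_n, L2loc Omega G &
  forall phi, admissible phi ->
    sigma phi + (\int[mu]_(x in D) dotv (mulmv (A x) (G x)) (gradient phi x) +
      \int[mu]_(x in D) (dotv (mulmv (A x) (G x)) (G x) * phi x)) <= 0.
Proof.
have [||||||||G LG qG] := @convex_fip R (T -> 'rV[R]_n) [set G | L2 G]
    (@L2sqr _ T R mu D n)
    ('rV[R]_n -> R) admissible wconstraint 2.
- by move=> F G s LF LG _; exact: (L2ZD mD s LF (L2Z mD (1 - s) LG)).
- by move=> f af; apply: (qf_convex mD mA bA sA pA); exact: wqf_data.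
- by move=> G _; exact: L2sqr_ge0.
- by move=> F G LF LG; exact: (L2sqr_parallelogram mD LF LG).
- by move=> F G H LF LG LH; exact: (L2sqr_triangle mD LF LG LH).
- by move=> u Lu uC; exact: (L2_complete mD Lu uC).
- move=> f u v C af Lu Lv uv qu.
  exact: (qf_closed mD mA bA sA pA (wqf_data af) Lu Lv uv qu).
- exact: wfeasible.
exists (fun x => r x *: G x).
  apply: (L2loc_bounded_mul oOmega mr LG) => K cK KO; have [j KU] := Ucov cK KO.
  have [c _ rc] := r_bounded j; exists c => x /KU Ux.
  by rewrite ger0_norm// rc.
move=> phi aphi; apply: le_trans (qG _ aphi); rewrite /wconstraint /qf lerD2l.
rewrite le_eqVlt; apply/orP; left; apply/eqP; congr (_ + _); apply: eq_Rintegral => x _.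
  by rewrite mulmvZ dotvZl dotvZr.
rewrite !mulmvZ !dotvZl dotvZr.
by move: (r x) (phi x) (dotv _ _) => a1 a2 a3; ring.
Qed.

End weight.

Lemma riccati_field : exists2 G : T -> 'rV[R]_n, L2loc Omega G &
  forall phi, admissible phi ->
    sigma phi + (\int[mu]_(x in D) dotv (mulmv (A x) (G x)) (gradient phi x) +
      \int[mu]_(x in D) (dotv (mulmv (A x) (G x)) (G x) * phi x)) <= 0.
Proof.
have [eta [U [teta eta1 oU UU Ucov]]] := smooth_exhaustion oOmega.
have mU j : measurable (U j : set T).
  by have [oUj _] := oU j; exact: open_lebesgue_measurable.
pose b j := (2 / m) * (1 + `|sigma (fun x => eta j x ^+ 2)| +
    2 * ipA (grad (eta j)) (grad (eta j))).
have B0 j : 0 <= \sum_(i < j.+1) b i.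
  apply: sumr_ge0 => i _.
  have p : 0 <= ipA (grad (eta i)) (grad (eta i)).
    by apply: Rintegral_ge0 => x; exact: pA.
  exact: coercivity_bound_ge0 (ltW m0) (normr_ge0 _) p.
have [w [mw w0 wU wint]] := summable_weight mu mD mU (fun j => (oU j).2) B0.
exact: (weighted_solution teta eta1 oU UU Ucov mw w0 wU wint).
Qed.

End duality.

(** * The theorem *)

Lemma measurable_form d (T : measurableType d) (R : realType) (D : set T) (n : nat)
    (A : T -> 'M[R]_n) (F G : T -> 'rV[R]_n) :
  (forall i j, measurable_fun D (fun x => A x i j)) ->
  (forall i, measurable_fun D (fun x => F x ord0 i)) ->
  (forall i, measurable_fun D (fun x => G x ord0 i)) ->
  measurable_fun D (fun x => dotv (mulmv (A x) (F x)) (G x)).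
Proof.
move=> mA mF mG.
rewrite (_ : (fun _ => _) =
    (fun x => \sum_i \sum_j A x i j * (F x ord0 j * G x ord0 i))); last first.
  by apply/funext => x; rewrite dotv_mulmv_sum.
apply: measurable_sum => i; apply: measurable_sum => j.
exact: measurable_funM (mA i j) (measurable_funM (mF j) (mG i)).
Qed.

Lemma ae_eq_Rintegral d (T : measurableType d) (R : realType)
    (mu : {measure set T -> \bar R}) (D : set T) (f g : T -> R) :
  measurable D -> measurable_fun D f -> measurable_fun D g ->
  {ae mu, forall x, D x -> f x = g x} ->
  \int[mu]_(x in D) f x = \int[mu]_(x in D) g x.
Proof.
move=> mD mf mg fg; congr fine; apply: ae_eq_integral => //.
- exact/measurable_EFinP.
- exact/measurable_EFinP.
- by apply: filterS fg => x /= fgx Dx; rewrite fgx.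
Qed.

Lemma enorm_coord (R : realType) (n : nat) (u : 'rV[R]_n) i : `|u ord0 i| <= enorm u.
Proof. by rewrite -sqrtr_sqr ler_wsqrtr// dotv_coord. Qed.

(* Changing [A] on a null set makes the ellipticity bounds hold everywhere. *)
Lemma elliptic_modification (R : realType) (n : nat) (Omega : set 'rV[R]_n)
    (A : 'rV[R]_n -> 'M[R]_n) : elliptic_matrix_field Omega A ->
  exists (B : lebesgueTypeRn R n -> 'M[R]_n) (m M : R),
  [/\ 0 < m /\ (forall i j, measurable_fun (Omega : set (lebesgueTypeRn R n))
        (fun x => B x i j)),
      forall x i j, Omega x -> `|B x i j| <= M,
      forall x, Omega x -> (B x)^T = B x,
      forall x u, Omega x -> m * dotv u u <= dotv (mulmv (B x) u) u &
      {ae @lebesgue_rV R n, forall x, Omega x -> A x = B x}].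
Proof.
move=> [mA sA [m [M [m0 M0 [N [mN muN NP]]]]]].
have good x : ~ N x -> Omega x -> forall u : 'rV[R]_n,
    m * enorm u ^+ 2 <= dotv (mulmv (A x) u) u /\ enorm (mulmv (A x) u) <= M * enorm u.
  by move=> nN Ox; apply: contrapT => nP; apply: nN; apply: NP => /= /(_ Ox).
(* The scalar matrix is symmetric and elliptic with the same [m]; its entries are at most [m], hence
   the maximum of [m] and [M] as entry bound. *)
pose B (x : lebesgueTypeRn R n) : 'M[R]_n := if x \in N then m%:M else A x.
have BN x : N x -> B x = m%:M by move=> Nx; rewrite /B mem_set.
have BA x : ~ N x -> B x = A x by move=> Nx; rewrite /B memNset.
exists B, m, (Num.max m M); split.
- split; first exact: m0.
  move=> i j.
  rewrite (_ : (fun _ => _) = (fun x => \1_N x * (m%:M : 'M[R]_n) i j +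
      (1 + -1 * \1_N x) * A x i j)).
    have mi : measurable_fun (Omega : set (lebesgueTypeRn R n))
        (\1_N : lebesgueTypeRn R n -> R) by exact: measurable_indic.
    have mN1 := measurable_funD (measurable_cst (1 : R))
      (measurable_funM (measurable_cst (-1 : R)) mi).
    exact: measurable_funD (measurable_funM mi (measurable_cst _))
      (measurable_funM mN1 (mA i j)).
  apply/funext => x; rewrite /B indicE; case: (x \in N).
    by rewrite mul1r mulr1 subrr mul0r addr0.
  by rewrite mul0r mulr0 addr0 add0r mul1r.
- move=> x i j Ox; rewrite le_max; have [Nx|nNx] := pselect (N x); apply/orP.
    left; rewrite BN// mxE; case: (i == j); first by rewrite mulr1n ger0_norm// ltW.
    by rewrite mulr0n normr0 ltW.
  (* The image of the unit vector [j] is column [j], of norm at most [M]. *)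
  right; rewrite BA//; have [_] := good x nNx Ox (delta_mx ord0 j).
  have -> : enorm (delta_mx ord0 j : 'rV[R]_n) = 1.
    rewrite /enorm /dotv (bigD1 j)//= big1 => [|k kj].
      by rewrite !mxE !eqxx mulr1 addr0 sqrtr1.
    by rewrite !mxE (negbTE kj) andbF mul0r.
  rewrite mulr1; apply: le_trans; apply: le_trans (enorm_coord _ i).
  by rewrite /mulmv -rowE !mxE.
- move=> x Ox; have [Nx|nNx] := pselect (N x); first by rewrite BN// tr_scalar_mx.
  by rewrite BA// sA.
- move=> x u Ox; have [Nx|nNx] := pselect (N x).
    by rewrite BN// /mulmv tr_scalar_mx mul_mx_scalar dotvZl.
  by rewrite BA// -enorm_sqr; have [] := good x nNx Ox u.
- exists N; split => // x /= nAB; apply: contrapT => nNx; apply: nAB => _.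
  by rewrite BA.
Qed.

Lemma le_subr_of_add_le0 (R : realFieldType) (s a b : R) :
  s + (a + b) <= 0 -> s <= - a - b.
Proof. by lra. Qed.

(** With [E = h Gamma], the letters [a], [b], [c] are the form at [E, E], at [E, grad h] and at
    [grad h, grad h]; the second hypothesis is its value at [E + grad h], in the shape that
    bilinearity produces. *)
Lemma complete_square (R : realFieldType) (s a b c : R) :
  s <= - (2 * b) - a -> 0 <= 1 * (1 * a + b) + (1 * b + c) -> s <= c.
Proof. by lra. Qed.

Unset Implicit Arguments.
Set Strict Implicit.
Set Printing Implicit Defensive.

Theorem theorem5p1 (R : realType) (n : nat) (hn : (0 < n)%N)
    (Omega : set 'rV[R]_n) (hOmega : open Omega)
    (sigma : ('rV[R]_n -> R) -> R) (hsigma : is_distribution Omega sigma)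
    (A : 'rV[R]_n -> 'M[R]_n) (hA : elliptic_matrix_field Omega A) :
  (forall h : 'rV[R]_n -> R, test_function Omega h ->
     sigma (fun x => h x ^+ 2) <=
     \int[lebesgue_rV]_(x in Omega)
        dotv (mulmv (A x) (gradient h x)) (gradient h x)) <->
  (exists Gamma : 'rV[R]_n -> 'rV[R]_n,
     L2loc Omega Gamma /\
     distr_le Omega sigma
       (fun phi =>
          distr_div Omega (fun x => mulmv (A x) (Gamma x)) phi -
          distr_fun Omega (fun x => dotv (mulmv (A x) (Gamma x)) (Gamma x))
            phi)).
Proof.
have mD := measurable_Omega hOmega.
have [mA _ _] := hA; have [B [m [M [[m0 mB] bB sB lB AB]]]] := elliptic_modification hA.
have mgrad h : test_function Omega h -> forall i, measurable_fun
    (Omega : set (lebesgueTypeRn R n))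
    (fun x : lebesgueTypeRn R n => gradient h x ord0 i).
  by move=> th i; have [] := test_gradient_L2 hOmega th i.
have aeAB (f : lebesgueTypeRn R n -> 'M[R]_n -> R) :
    {ae @lebesgue_rV R n, forall x, Omega x -> f x (A x) = f x (B x)}.
  case: AB => N [mN N0 NP]; exists N; split=> [||x /= nf]; [exact: mN|exact: N0|].
  by apply: NP => /= ABx; apply: nf => Ox; rewrite (ABx Ox).
have formE (F G : lebesgueTypeRn R n -> 'rV[R]_n) :
    (forall i, measurable_fun (Omega : set (lebesgueTypeRn R n)) (fun x => F x ord0 i)) ->
    (forall i, measurable_fun (Omega : set (lebesgueTypeRn R n)) (fun x => G x ord0 i)) ->
    \int[lebesgue_rV]_(x in Omega) dotv (mulmv (A x) (F x)) (G x) =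
    \int[lebesgue_rV]_(x in Omega) dotv (mulmv (B x) (F x)) (G x).
  move=> mF mG; apply: (ae_eq_Rintegral mD (measurable_form mA mF mG)
    (measurable_form mB mF mG)).
  exact: (aeAB (fun x C => dotv (mulmv C (F x)) (G x))).
have formpE (F : lebesgueTypeRn R n -> 'rV[R]_n) (p : 'rV[R]_n -> R) :
    (forall i, measurable_fun (Omega : set (lebesgueTypeRn R n)) (fun x => F x ord0 i)) ->
    measurable_fun (Omega : set (lebesgueTypeRn R n)) (p : lebesgueTypeRn R n -> R) ->
    \int[lebesgue_rV]_(x in Omega) (dotv (mulmv (A x) (F x)) (F x) * p x) =
    \int[lebesgue_rV]_(x in Omega) (dotv (mulmv (B x) (F x)) (F x) * p x).
  move=> mF mp; apply: (ae_eq_Rintegral mD).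
  - exact: measurable_funM (measurable_form mA mF mF) mp.
  - exact: measurable_funM (measurable_form mB mF mF) mp.
  - exact: (aeAB (fun x C => dotv (mulmv C (F x)) (F x) * p x)).
split=> [form|[Gamma [LGamma le]] h th].
  have [|G LG Gle] := riccati_field hOmega hsigma.1 mB bB sB m0 lB.
    move=> h th; apply: le_trans (form h th) _.
    by rewrite le_eqVlt; apply/orP; left; apply/eqP; apply: formE; exact: mgrad.
  exists G; split => // phi tphi phi0.
  rewrite /distr_div /distr_fun (formE _ _ LG.1 (mgrad _ tphi)) formpE; last 2 first.
  - exact: LG.1.
  - by apply: test_measurable; case: tphi.
  exact: le_subr_of_add_le0 (Gle phi (conj tphi phi0)).
have [sh ch hO] := th; have Lh := test_gradient_L2 hOmega th.
have th2 := test_function_sqr th.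
have [C _ hC] := test_bounded th.
have := le _ th2 (fun x => sqr_ge0 (h x)).
rewrite /distr_div /distr_fun (formE _ _ LGamma.1 (mgrad _ th2)) formpE; last 2 first.
- exact: LGamma.1.
- by apply: test_measurable; case: th2.
rewrite (formE _ _ (mgrad _ th) (mgrad _ th)).
(* This is [h Gamma]: the indicator does not change it and makes its global square integrability
   follow from the local one of [Gamma]. *)
pose E : lebesgueTypeRn R n -> 'rV[R]_n :=
  fun x => h x *: ((\1_(fsupp h) x : R) *: Gamma x).
have LE : L2 lebesgue_rV (Omega : set (lebesgueTypeRn R n)) E.
  apply: (@L2_mul _ _ _ _ _ mD _ _ _ C) => [||].
  - exact: test_measurable.
  - by move=> x _; exact: hC.
  - exact: (L2loc_restrict hOmega LGamma ch hO).
have hE x : h x * \1_(fsupp h) x = h x.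
  have [hx|/fsupp_eq0 ->] := pselect (fsupp h x); last by rewrite mul0r.
  by rewrite indicE mem_set// mulr1.
set form := ip lebesgue_rV (Omega : set (lebesgueTypeRn R n)) B.
have -> : \int[lebesgue_rV]_(x in Omega) dotv (mulmv (B x) (Gamma x))
    (gradient (fun y => h y ^+ 2) x) = 2 * form E (gradient h).
  rewrite /form -(ipZl mD mB bB 2 LE Lh); apply: eq_Rintegral => x _.
  have -> : (2 *: E) x = 2 *: (h x *: ((\1_(fsupp h) x : R) *: Gamma x)) by [].
  rewrite (_ : (fun y => h y ^+ 2) = (fun y => h y * h y))// gradientM//.
  rewrite [X in 2 *: X]scalerA hE !mulmvZ !dotvZl dotvDr !dotvZr.
  by rewrite mulr_natl mulr2n.
have -> : \int[lebesgue_rV]_(x in Omega) (dotv (mulmv (B x) (Gamma x)) (Gamma x) *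
    h x ^+ 2) = form E E.
  apply: eq_Rintegral => x _; rewrite /E scalerA hE !mulmvZ !dotvZl dotvZr.
  by rewrite mulrA -expr2 mulrC.
move=> /complete_square; apply.
pose grad : lebesgueTypeRn R n -> 'rV[R]_n := gradient h.
pose S := 1 *: E + grad; have LS : L2 lebesgue_rV (Omega : set (lebesgueTypeRn R n)) S.
  exact: (L2ZD mD 1 LE Lh).
have S0 : 0 <= form S S.
  apply: Rintegral_ge0 => x Ox; apply: le_trans (lB _ _ Ox).
  by apply: mulr_ge0; [exact: ltW|exact: dotv_ge0].
have SE : form S S = 1 * form E S + form grad S := ipZDl mD mB bB 1 LE Lh LS.
have ES : form E S = 1 * form E E + form E grad := ipZDr mD mB bB 1 LE Lh LE.
have gS : form grad S = 1 * form grad E + form grad grad := ipZDr mD mB bB 1 LE Lh Lh.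
have gE : form grad E = form E grad by exact: ipC.
by rewrite SE ES gS gE in S0.
Qed.
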